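(* Let $(R,\mathfrak m)$ be a Cohen-Macaulay local ring of dimension two with infinite residue field and let $I,J$ be $\mathfrak m$-primary ideals of $R$. Let $r_0,s_0\ge0$ be integers. Assume that $(a,b)$ is a joint reduction of $I$ and $J$ such that $$(a)\cap I^{r_0+k}J^{s_0}=aI^{r_0+k-1}J^{s_0}\quad\text{and}\quad (b)\cap I^{r_0}J^{s_0+k}=bI^{r_0}J^{s_0+k-1}\quad\text{for all }k\ge1.$$ Then the following statements are equivalent: (a) $(r_0,s_0)\in\Lambda(I|J)$; (b) $e_{(0,1)}=g_1(r_0)+r_0e_{(1,1)}$, $e_{(1,0)}=h_1(s_0)+s_0e_{(1,1)}$ and $$e_2(IJ)=g_2(r_0)+h_2(s_0)-\ell(R/I^{r_0}J^{s_0})+r_0s_0e_{(1,1)}+\ell\left(\frac{\widetilde{\mathcal F}_{(a,b)}(I^{r_0},J^{s_0})}{I^{r_0}J^{s_0}}\right);$$ (c) $[H^2_{(at_1,bt_2)}(\mathcal R')]_{(r_0,s_0)}=0$.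
   Context: $\ell$ denotes length of $R$-modules. $I^n=J^n=R$ for $n\le0$. A pair $(a,b)$ is a joint reduction of $I$ and $J$ if $a\in I$, $b\in J$ and $I^{r+1}J^{s+1}=aI^rJ^{s+1}+bI^{r+1}J^s$ for all large $r,s$. The joint reduction lattice is $\Lambda(I|J):=\{(r,s)\in\mathbb N^2: I^{r+1}J^{s+1}=a'I^rJ^{s+1}+b'I^{r+1}J^s\text{ for some joint reduction }(a',b')\text{ of }I\text{ and }J\}$ (with $0\in\mathbb N$). $\mathcal R'=\bigoplus_{r,s\in\mathbb Z}I^rJ^st_1^rt_2^s\subseteq R[t_1^{\pm1},t_2^{\pm1}]$ is the bigraded extended Rees algebra; $H^2_{(at_1,bt_2)}(\mathcal R')$ is its second local cohomology module with support in the ideal $(at_1,bt_2)$, and $[\,\cdot\,]_{(r,s)}$ is the bigraded component. $\widetilde{\mathcal F}_{(a,b)}(I^r,J^s):=\bigcup_{k\ge1}\big((I^{r+k}J^s:a^k)\cap(I^rJ^{s+k}:b^k)\big)$. Hilbert coefficients: for an $\mathfrak m$-primary ideal $K$, $\ell(R/K^n)=e_0(K)\binom{n+1}{2}-e_1(K)n+e_2(K)$ for $n\gg0$. Bigraded Hilbert coefficients $e_{(i,j)}$ of $\{I^rJ^s\}$: $\ell(R/I^rJ^s)=\sum_{i+j\le 2}(-1)^{i+j}e_{(i,j)}\binom{r+i-1}{i}\binom{s+j-1}{j}$ for all $r,s\gg0$. For each fixed $r\ge0$ there are integers $g_1(r),g_2(r)$ with $\ell(R/I^rJ^s)=e_0(J)\binom{s+1}{2}-g_1(r)s+g_2(r)$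 for all $s\gg0$; for each fixed $s\ge0$ there are integers $h_1(s),h_2(s)$ with $\ell(R/I^rJ^s)=e_0(I)\binom{r+1}{2}-h_1(s)r+h_2(s)$ for all $r\gg0$. *)

(* Defs.v *)
From HB Require Import structures.
From mathcomp Require Import all_boot all_order all_algebra ring zify.
From mathcomp Require Import finmap monalg.
From mathcomp Require Import boolp classical_sets cardinality.

Set Implicit Arguments.
Unset Strict Implicit.
Unset Printing Implicit Defensive.

Import GRing.Theory.

Local Open Scope classical_set_scope.
Local Open Scope ring_scope.
Local Open Scope quotient_scope.

(** MathComp's [idealr] predicates are proper by definition, whereas the unit
    ideal [I^0 = R] is needed here; ideals are therefore sets [I : set R]
    satisfying [is_ideal]. *)

Section Ideals.
Variable R : comNzRingType.
Implicit Types (I J K M N P Q m : set R) (a b x y : R).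

Definition is_ideal I : Prop :=
  [/\ I 0, forall x y, I x -> I y -> I (x + y) & forall c x, I x -> I (c * x)].

Definition ideal_gen (A : set R) : set R := smallest is_ideal A.

Definition idealD I J : set R := [set x + y | x in I & y in J].

Definition idealM I J : set R := ideal_gen [set x * y | x in I & y in J].

Definition idealX I (n : nat) : set R := iter n (idealM I) setT.

Definition scale_ideal a K : set R := [set a * x | x in K].
Definition colon K a : set R := [set x | K (a * x)].

(** [I^r J^s]; for integer exponents, [I^n = J^n = R] when [n <= 0]. *)
Definition IJpow I J (r s : nat) : set R := idealM (idealX I r) (idealX J s).

Definition int_idealX I (n : int) : set R :=
  if n is Posz k then idealX I k else setT.

Definition IJpowz I J (r s : int) : set R :=
  idealM (int_idealX I r) (int_idealX J s).

Definition prime_ideal P : Prop :=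
  [/\ is_ideal P, ~ P 1 & forall x y, P (x * y) -> P x \/ P y].

Definition maximal_ideal m : Prop :=
  [/\ is_ideal m, ~ m 1 & forall K, is_ideal K -> m `<=` K -> K = m \/ K = setT].

Definition primary_ideal Q : Prop :=
  [/\ is_ideal Q, ~ Q 1 &
      forall x y, Q (x * y) -> Q x \/ exists n : nat, Q (y ^+ n)].

Definition radical Q : set R := [set x | exists n : nat, Q (x ^+ n)].

Definition m_primary m Q : Prop := primary_ideal Q /\ radical Q = m.

Definition noetherian : Prop :=
  forall K, is_ideal K -> exists s : seq R, K = ideal_gen [set` s].

Definition local_ring m : Prop :=
  maximal_ideal m /\ forall n, maximal_ideal n -> n = m.

(** [R/m] is realised as the set of the cosets [x + m]. *)
Definition infinite_residue_field m : Prop :=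
  infinite_set (range (fun x : R => [set y | m (y - x)])).

Definition strict_chain (F : set (set R)) (k : nat) : Prop :=
  exists L : nat -> set R,
    (forall i, (i <= k)%N -> F (L i)) /\
    (forall i, (i < k)%N -> L i `<` L i.+1).

Definition max_chain_length (F : set (set R)) (n : nat) : Prop :=
  strict_chain F n /\ forall k, strict_chain F k -> (k <= n)%N.

Definition krull_dim (n : nat) : Prop := max_chain_length prime_ideal n.

Definition regular_sequence (s : seq R) : Prop :=
  ~ ideal_gen [set` s] 1 /\
  forall i, (i < size s)%N -> forall z,
    ideal_gen [set` take i s] (nth 0 s i * z) -> ideal_gen [set` take i s] z.

Definition regular_sequence_in m (s : seq R) : Prop :=
  regular_sequence s /\ [set` s] `<=` m.

Definition depth m (n : nat) : Prop :=
  (exists2 s, regular_sequence_in m s & size s = n) /\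
  (forall s, regular_sequence_in m s -> (size s <= n)%N).

Definition cohen_macaulay_local m : Prop :=
  [/\ noetherian, local_ring m & exists2 d, krull_dim d & depth m d].

(** The submodules of [M/N] are the [K/N] for the ideals [N <= K <= M], so
    [quo_length M N] is the length of the [R]-module [M/N]; it is [0] by convention
    if that length is infinite. *)

Definition quo_length M N : nat :=
  xget 0%N [set n | max_chain_length
                      [set K | [/\ is_ideal K, N `<=` K & K `<=` M]] n].

Definition colength K : nat := quo_length setT K.

Definition joint_reduction_eq I J a b (r s : nat) : Prop :=
  IJpow I J r.+1 s.+1 =
  idealD (scale_ideal a (IJpow I J r s.+1)) (scale_ideal b (IJpow I J r.+1 s)).

Definition joint_reduction I J a b : Prop :=
  [/\ I a, J b &
      exists N : nat, forall r s : nat, (N <= r)%N -> (N <= s)%N ->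
        joint_reduction_eq I J a b r s].

Definition joint_reduction_lattice I J : set (nat * nat) :=
  [set rs | exists a b,
     joint_reduction I J a b /\ joint_reduction_eq I J a b rs.1 rs.2].

Definition Ftilde I J a b (r s : nat) : set R :=
  \bigcup_(k in [set k : nat | (1 <= k)%N])
    (colon (IJpow I J (r + k) s) (a ^+ k) `&`
     colon (IJpow I J r (s + k)) (b ^+ k)).

(** The coefficients are the values determined by the identities below, which
    hold for all large arguments. *)

Definition hilbert_coefs K (e : nat -> int) : Prop :=
  exists N : nat, forall n : nat, (N <= n)%N ->
    (colength (idealX K n))%:Z =
    e 0%N * 'C(n + 1, 2)%:Z - e 1%N * n%:Z + e 2%N.

Definition bigraded_hilbert_coefs I J (e : nat -> nat -> int) : Prop :=
  exists N : nat, forall r s : nat, (N <= r)%N -> (N <= s)%N ->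
    (colength (IJpow I J r s))%:Z =
    \sum_(i < 3) \sum_(j < 3 | (i + j <= 2)%N)
       (-1) ^+ (i + j) * e i j * 'C(r + i - 1, i)%:Z * 'C(s + j - 1, j)%:Z.

(** [ℓ(R/I^r J^s)] with [r] fixed and [s] large, and vice versa;
    [e0J] and [e0I] stand for [e_0(J)] and [e_0(I)]. *)
Definition row_coefs I J (e0J : int) (g1 g2 : nat -> int) : Prop :=
  forall r : nat, exists N : nat, forall s : nat, (N <= s)%N ->
    (colength (IJpow I J r s))%:Z = e0J * 'C(s + 1, 2)%:Z - g1 r * s%:Z + g2 r.

Definition col_coefs I J (e0I : int) (h1 h2 : nat -> int) : Prop :=
  forall s : nat, exists N : nat, forall r : nat, (N <= r)%N ->
    (colength (IJpow I J r s))%:Z = e0I * 'C(r + 1, 2)%:Z - h1 s * r%:Z + h2 s.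

Lemma ideal_gen_ideal (A : set R) : is_ideal (ideal_gen A).
Proof.
split=> [K [[]]//|x y Ax Ay K KA|c x Ax K KA]; have [[_ KD KM] _] := KA.
- by apply: KD; [apply: Ax|apply: Ay].
- by apply: KM; apply: Ax.
Qed.

Lemma idealX_ideal I n : is_ideal (idealX I n).
Proof. by case: n => [|n]; [split|exact: ideal_gen_ideal]. Qed.

Lemma int_idealX_ideal I n : is_ideal (int_idealX I n).
Proof. by case: n => n; [exact: idealX_ideal|split]. Qed.

Lemma idealM_mem I J x y : I x -> J y -> idealM I J (x * y).
Proof. by move=> Ix Jy; apply: sub_gen_smallest; exists x => //; exists y. Qed.

Lemma idealM_sub I J K : is_ideal K ->
  (forall x y, I x -> J y -> K (x * y)) -> idealM I J `<=` K.
Proof. by move=> KI H; apply: smallest_sub => // _ [x Ix] [y Jy] <-; apply: H. Qed.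

Lemma idealX_le I n p : (n <= p)%N -> idealX I p `<=` idealX I n.
Proof.
move=> /subnK <-; elim: (p - n)%N => // k IH.
apply: idealM_sub; first exact: idealX_ideal.
by move=> x y _ /IH; case: (idealX_ideal I n) => _ _; apply.
Qed.

Lemma idealX_mul I n p x y :
  idealX I n x -> idealX I p y -> idealX I (n + p) (x * y).
Proof.
move=> Ix Iy; elim: n x Ix => [|n IH] x Ix.
  by case: (idealX_ideal I p) => _ _; apply.
have [K0 KD KM] := idealX_ideal I (n.+1 + p).
pose K := [set z | idealX I (n.+1 + p) (z * y)].
suff: idealX I n.+1 `<=` K by apply.
apply: idealM_sub => [|u v Iu Iv]; first split => [|u v|c u]; rewrite /K /=.
- by rewrite mul0r.
- by rewrite mulrDl => Hu Hv; apply: KD.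
- by rewrite -mulrA => Hu; apply: KM.
- by rewrite -mulrA; apply: idealM_mem => //; apply: IH.
Qed.

Lemma int_idealXE I z : int_idealX I z = idealX I (if z is Posz k then k else 0%N).
Proof. by case: z. Qed.

Lemma int_idealX_mul I z w x y :
  int_idealX I z x -> int_idealX I w y -> int_idealX I (z + w) (x * y).
Proof.
rewrite !int_idealXE => Ix Iy.
have := idealX_mul Ix Iy; apply: idealX_le.
case: z w {Ix Iy} => [k|k] [l|l] //=.
- by case E: (k%:Z + Negz l) => [q|q] //; lia.
- by case E: (Negz k + l%:Z) => [q|q] //; lia.
Qed.

Lemma IJpowz_ideal I J r s : is_ideal (IJpowz I J r s).
Proof. exact: ideal_gen_ideal. Qed.

Lemma IJpowz_mul I J r s r' s' x y :
  IJpowz I J r s x -> IJpowz I J r' s' y ->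
  IJpowz I J (r + r') (s + s') (x * y).
Proof.
move=> Hx Hy; have [K0 KD KM] := IJpowz_ideal I J (r + r') (s + s').
suff: IJpowz I J r s `<=` [set x | IJpowz I J (r + r') (s + s') (x * y)] by apply.
apply: idealM_sub => [|u v Iu Jv] /=.
  split => [|u v|c u] /=; first by rewrite mul0r.
  - by rewrite mulrDl; apply: KD.
  - by rewrite -mulrA; apply: KM.
suff: IJpowz I J r' s' `<=` [set y | IJpowz I J (r + r') (s + s') (u * v * y)] by apply.
apply: idealM_sub => [|u' v' Iu' Jv'] /=.
  split => [|w z|c w] /=; first by rewrite mulr0.
  - by rewrite mulrDr; apply: KD.
  - by rewrite mulrCA; apply: KM.
by rewrite mulrACA; apply: idealM_mem; apply: int_idealX_mul.
Qed.

End Ideals.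

(** Laurent polynomials [R[t1^±1, t2^±1]]: [{malg R[bideg]}] is the module of
    finitely supported functions [bideg -> R], [f@_(r, s)] being the coefficient of [t1^r t2^s].
    The algebra structure that [monalg] puts on [{malg R[K]}] is unavailable
    here, since its monomials have no inverses. *)

Notation bideg := (int * int)%type.

Definition laurent (R : comNzRingType) := {malg R[bideg]}.

HB.instance Definition _ (R : comNzRingType) := Choice.on (laurent R).
HB.instance Definition _ (R : comNzRingType) := GRing.Zmodule.on (laurent R).

Section Laurent.
Variable R : comNzRingType.
Implicit Types (f g h : laurent R) (d e : bideg) (c : R).

Definition lmonom c d : laurent R := mkmalgU d c.

Definition lcoef d f : R := mcoeff d f.

Definition laurent_mul f g : laurent R :=
  \sum_(d <- msupp f) \sum_(e <- msupp g) lmonom (lcoef d f * lcoef e g) (d + e).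

Definition laurent_one : laurent R := lmonom 1 0.

Let lmul_w (A B : {fset bideg}) f g :
  (msupp f `<=` A)%fset -> (msupp g `<=` B)%fset ->
  laurent_mul f g =
  \sum_(d <- A) \sum_(e <- B) lmonom (lcoef d f * lcoef e g) (d + e).
Proof.
move=> fA gB; rewrite /laurent_mul (big_fset_incl _ fA) /=.
  apply: eq_bigr => d _; apply/big_fset_incl => // e _ /mcoeff_outdom.
  by rewrite /lcoef => ->; rewrite mulr0 /lmonom monalgU0.
move=> d _ /mcoeff_outdom; rewrite /lcoef => ->.
by rewrite big1 // => e _; rewrite mul0r /lmonom monalgU0.
Qed.

Let lmonomM c d c' e :
  laurent_mul (lmonom c d) (lmonom c' e) = lmonom (c * c') (d + e)%R.
Proof.
rewrite (@lmul_w (fset1 d) (fset1 e) _ _ msuppU_le msuppU_le).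
by rewrite !big_seq_fset1 /lcoef !mcoeffUU.
Qed.

Let lmulC : commutative laurent_mul.
Proof.
move=> f g; rewrite /laurent_mul exchange_big; apply: eq_bigr => e _.
by apply: eq_bigr => d _; rewrite mulrC addrC.
Qed.

Let lmulDl : left_distributive laurent_mul +%R.
Proof.
move=> f g h; rewrite (lmul_w (msuppD_le _ _) (fsubset_refl _)).
rewrite (lmul_w (fsubsetUl _ (msupp g)) (fsubset_refl _)).
rewrite (lmul_w (fsubsetUr (msupp f) _) (fsubset_refl _)).
rewrite -big_split; apply: eq_bigr => d _; rewrite -big_split; apply: eq_bigr => e _.
by rewrite /lcoef mcoeffD mulrDl /lmonom monalgUD.
Qed.

Let lmul0 : left_zero 0 laurent_mul.
Proof. by move=> f; rewrite /laurent_mul msupp0 big_seq_fset0. Qed.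

Let lmulDr : right_distributive laurent_mul +%R.
Proof. by move=> f g h; rewrite ![laurent_mul f _]lmulC lmulDl. Qed.

Let lmulr0 : right_zero 0 laurent_mul.
Proof. by move=> f; rewrite lmulC lmul0. Qed.

Let lmul1 : left_id laurent_one laurent_mul.
Proof.
move=> f; rewrite (@lmul_w (fset1 0) (msupp f) _ _ msuppU_le (fsubset_refl _)) big_seq_fset1.
rewrite [RHS](monalgE (f : {malg R[bideg]})); apply: eq_bigr => d _.
by rewrite /lcoef mcoeffUU mul1r add0r.
Qed.

Lemma laurent_ind (P : laurent R -> Prop) :
  P 0 -> (forall f g, P f -> P g -> P (f + g)) -> (forall c d, P (lmonom c d)) ->
  forall f, P f.
Proof.
move=> P0 PD PU f; rewrite (monalgE (f : {malg R[bideg]})).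
by apply: (big_ind P) => // d _; apply: PU.
Qed.

Let bilinear_assoc (mul : laurent R -> laurent R -> laurent R) :
  left_zero 0 mul -> right_zero 0 mul ->
  left_distributive mul +%R -> right_distributive mul +%R ->
  (forall c d c' e, mul (lmonom c d) (lmonom c' e) = lmonom (c * c') (d + e)) ->
  associative mul.
Proof.
move=> l0 r0 Dl Dr monM f g h; elim/laurent_ind: f => [|f f' Hf Hf'|c d].
- by rewrite !l0.
- by rewrite !Dl Hf Hf'.
elim/laurent_ind: g => [|g g' Hg Hg'|c' e].
- by rewrite l0 !r0 l0.
- by rewrite Dl !Dr Dl Hg Hg'.
elim/laurent_ind: h => [|h h' Hh Hh'|c'' k].
- by rewrite !r0.
- by rewrite !Dr Hh Hh'.
by rewrite !monM mulrA addrA.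
Qed.

Let lmulA : associative laurent_mul.
Proof. exact: bilinear_assoc lmul0 lmulr0 lmulDl lmulDr lmonomM. Qed.

Let lone_neq0 : laurent_one != 0.
Proof.
apply/eqP => /(congr1 (lcoef 0)) /eqP.
by rewrite /lcoef mcoeffUU mcoeff0 oner_eq0.
Qed.

HB.instance Definition _ := GRing.Zmodule_isComNzRing.Build (laurent R)
  lmulA lmulC lmul1 lmulDl lone_neq0.

Lemma lcoefD d f g : lcoef d (f + g) = lcoef d f + lcoef d g.
Proof. exact: mcoeffD. Qed.

Lemma lcoefN d f : lcoef d (- f) = - lcoef d f.
Proof. exact: mcoeffN. Qed.

Lemma lcoef_monom c d e : lcoef e (lmonom c d) = c *+ (d == e).
Proof. exact: mcoeffU. Qed.

Lemma laurentME f g :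
  f * g = \sum_(d <- msupp f) \sum_(e <- msupp g)
            lmonom (lcoef d f * lcoef e g) (d + e).
Proof. exact: (erefl (laurent_mul f g)). Qed.

End Laurent.

Section Rees.
Variables (R : comNzRingType) (I J : set R).

Definition rees_pred : {pred laurent R} :=
  fun f => `[< forall d : bideg, IJpowz I J d.1 d.2 (lcoef d f) >].

Let rees_subring : subring_closed rees_pred.
Proof.
have mon c d : IJpowz I J d.1 d.2 c -> lmonom c d \in rees_pred.
  move=> Ic; apply/asboolP => e; rewrite lcoef_monom.
  by case: eqP => [<-//|_]; case: (IJpowz_ideal I J e.1 e.2).
have add f g : f \in rees_pred -> g \in rees_pred -> f + g \in rees_pred.
  move=> /asboolP fP /asboolP gP; apply/asboolP => e; rewrite lcoefD.
  by case: (IJpowz_ideal I J e.1 e.2) => _ + _; apply.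
have zero : 0 \in rees_pred.
  apply/asboolP => e; rewrite /lcoef mcoeff0.
  by case: (IJpowz_ideal I J e.1 e.2).
split=> [|f g fP gP|f g fP gP].
- by apply: mon; rewrite -[1]mulr1; apply: idealM_mem.
- apply: add => //; apply/asboolP => e; rewrite lcoefN -mulN1r.
  by case: (IJpowz_ideal I J e.1 e.2) => _ _; apply; move/asboolP: gP; apply.
rewrite laurentME; apply: (big_ind (fun h => h \in rees_pred)) => // d _.
apply: (big_ind (fun h => h \in rees_pred)) => // e _; apply: mon.
by apply: IJpowz_mul; [move/asboolP: fP|move/asboolP: gP]; apply.
Qed.

HB.instance Definition _ :=
  GRing.isSubringClosed.Build (laurent R) rees_pred rees_subring.

Definition rees : Type := {f : laurent R | f \in rees_pred}.

HB.instance Definition _ := SubType.on rees.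
HB.instance Definition _ := Choice.on rees.
HB.instance Definition _ := [SubChoice_isSubComNzRing of rees by <:].

Definition rees_homog (d : bideg) : set rees :=
  [set f | forall e, e != d -> lcoef e (val f) = 0].

(** [a t1] and [b t2]; the default value [0] of [insubd] is not reached when
    [a] is in [I] and [b] is in [J], see [val_rees_t1] and [val_rees_t2]. *)
Definition rees_t1 (a : R) : rees := insubd (0 : rees) (lmonom a (1, 0)).
Definition rees_t2 (b : R) : rees := insubd (0 : rees) (lmonom b (0, 1)).

Let lmonom_rees c d : IJpowz I J d.1 d.2 c -> lmonom c d \in rees_pred.
Proof.
move=> Ic; apply/asboolP => e; rewrite lcoef_monom.
by case: eqP => [<-//|_]; case: (IJpowz_ideal I J e.1 e.2).
Qed.

Lemma val_rees_t1 a : I a -> val (rees_t1 a) = lmonom a (1, 0).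
Proof.
move=> Ia; rewrite insubdK //; apply: lmonom_rees => /=.
by rewrite -[a]mulr1; apply: idealM_mem => //; rewrite -[a]mulr1; apply: idealM_mem.
Qed.

Lemma val_rees_t2 b : J b -> val (rees_t2 b) = lmonom b (0, 1).
Proof.
move=> Jb; rewrite insubdK //; apply: lmonom_rees => /=.
by rewrite -[b]mul1r; apply: idealM_mem => //; rewrite -[b]mulr1; apply: idealM_mem.
Qed.

End Rees.

(** [loc f] is the additive group of the localization [S_f]; [frac f s n] is
    the fraction [s / f^n]. *)

Section Localization.
Variables (S : comNzRingType) (f : S).
Implicit Types u v : S * nat.

Definition loc_eq u v : bool :=
  `[< exists k : nat, f ^+ k * (u.1 * f ^+ v.2 - v.1 * f ^+ u.2) = 0 >].

Let loc_equiv : equiv_class_of loc_eq.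
Proof.
split=> [[s n]|u v|[t n] [s m] [w p]].
- by apply/asboolP; exists 0%N; rewrite subrr mulr0.
- by apply/asboolP/asboolP => -[k H]; exists k; rewrite -opprB mulrN H oppr0.
move=> /asboolP[k /= H] /asboolP[l /= H']; apply/asboolP; exists (k + l + n)%N => /=.
transitivity (f ^+ l * f ^+ p * (f ^+ k * (s * f ^+ n - t * f ^+ m))
  + f ^+ k * f ^+ m * (f ^+ l * (t * f ^+ p - w * f ^+ n))).
  by rewrite !exprD; move: (f ^+ k) (f ^+ l) (f ^+ n) (f ^+ m) (f ^+ p); move=> *; ring.
by rewrite H H' !mulr0 addr0.
Qed.

Canonical loc_equivRel := EquivRelPack loc_equiv.
Canonical loc_encModRel := defaultEncModRel loc_eq.

Definition loc : Type := {eq_quot loc_eq}.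

HB.instance Definition _ := Choice.on loc.
HB.instance Definition _ : EqQuotient (S * nat)%type loc_eq loc := EqQuotient.on loc.

Definition frac (s : S) (n : nat) : loc := \pi_loc (s, n).

Definition num (x : loc) : S := (repr x).1.
Definition den (x : loc) : nat := (repr x).2.

Lemma fracK x : frac (num x) (den x) = x.
Proof. by rewrite /frac /num /den -surjective_pairing reprK. Qed.

Lemma frac_eqP s n t m :
  frac s n = frac t m <-> exists k, f ^+ k * (s * f ^+ m - t * f ^+ n) = 0.
Proof.
split=> [/eqmodP/asboolP//|H].
by apply/eqmodP/asboolP.
Qed.

Definition loc_add (x y : loc) : loc :=
  frac (num x * f ^+ den y + num y * f ^+ den x) (den x + den y).
Definition loc_opp (x : loc) : loc := frac (- num x) (den x).

Let frac_rep s n : exists k,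
  f ^+ k * (num (frac s n) * f ^+ n - s * f ^+ den (frac s n)) = 0.
Proof. by apply/frac_eqP; rewrite fracK. Qed.

Let loc_addE s n t m :
  loc_add (frac s n) (frac t m) = frac (s * f ^+ m + t * f ^+ n) (n + m).
Proof.
have [k Hk] := frac_rep s n; have [l Hl] := frac_rep t m.
apply/frac_eqP; exists (k + l)%N.
transitivity (f ^+ l * f ^+ m * f ^+ den (frac t m) *
    (f ^+ k * (num (frac s n) * f ^+ n - s * f ^+ den (frac s n)))
  + f ^+ k * f ^+ n * f ^+ den (frac s n) *
    (f ^+ l * (num (frac t m) * f ^+ m - t * f ^+ den (frac t m)))).
  rewrite !exprD; move: (num _) (num _) (f ^+ den _) (f ^+ den _) {Hk Hl}.
  by move: (f ^+ k) (f ^+ l) (f ^+ n) (f ^+ m) => *; ring.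
by rewrite Hk Hl !mulr0 addr0.
Qed.

Let loc_oppE s n : loc_opp (frac s n) = frac (- s) n.
Proof.
have [k Hk] := frac_rep s n; apply/frac_eqP; exists k.
by rewrite !mulNr -opprD mulrN Hk oppr0.
Qed.

Let loc_addA : associative loc_add.
Proof.
move=> x y z; rewrite -[x]fracK -[y]fracK -[z]fracK !loc_addE.
rewrite -addnA !exprD; congr frac.
by move: (num _) (num _) (num _) (f ^+ _) (f ^+ _) (f ^+ _) => *; ring.
Qed.

Let loc_addC : commutative loc_add.
Proof. by move=> x y; rewrite /loc_add addrC addnC. Qed.

Let loc_add0 : left_id (frac 0 0) loc_add.
Proof.
by move=> x; rewrite -[x]fracK loc_addE mul0r add0r expr0 mulr1 add0n.
Qed.

Let loc_addN : left_inverse (frac 0 0) loc_opp loc_add.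
Proof.
move=> x; rewrite -[x]fracK loc_oppE loc_addE mulNr addNr.
by apply/frac_eqP; exists 0%N; rewrite !mul0r subrr mulr0.
Qed.

HB.instance Definition _ := GRing.isZmodule.Build loc
  loc_addA loc_addC loc_add0 loc_addN.

Lemma fracD s n t m :
  frac s n + frac t m = frac (s * f ^+ m + t * f ^+ n) (n + m).
Proof. exact: loc_addE. Qed.

Lemma fracN s n : - frac s n = frac (- s) n.
Proof. exact: loc_oppE. Qed.

End Localization.

(** The second local cohomology with support in [(x, y)] is the cohomology in
    degree 2 of the Čech complex
    [0 -> S -> S_x ⊕ S_y -> S_xy -> 0], hence the cokernel of its last map. *)

Section LocalCohomology.
Variables (S : comNzRingType) (x y : S).

Definition loc_left (u : loc x) : loc (x * y) :=
  frac (x * y) (num u * y ^+ den u) (den u).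
Definition loc_right (v : loc y) : loc (x * y) :=
  frac (x * y) (num v * x ^+ den v) (den v).

Lemma loc_left_frac s n : loc_left (frac x s n) = frac (x * y) (s * y ^+ n) n.
Proof.
have /frac_eqP[k Hk] := fracK (frac x s n); apply/frac_eqP; exists k.
transitivity (y ^+ k * y ^+ n * y ^+ den (frac x s n) *
  (x ^+ k * (num (frac x s n) * x ^+ n - s * x ^+ den (frac x s n)))).
  rewrite !exprMn; move: (num _) (x ^+ den _) (y ^+ den _) {Hk}.
  by move: (x ^+ k) (y ^+ k) (x ^+ n) (y ^+ n) => *; ring.
by rewrite Hk mulr0.
Qed.

Lemma loc_right_frac s n : loc_right (frac y s n) = frac (x * y) (s * x ^+ n) n.
Proof.
have /frac_eqP[k Hk] := fracK (frac y s n); apply/frac_eqP; exists k.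
transitivity (x ^+ k * x ^+ n * x ^+ den (frac y s n) *
  (y ^+ k * (num (frac y s n) * y ^+ n - s * y ^+ den (frac y s n)))).
  rewrite !exprMn; move: (num _) (x ^+ den _) (y ^+ den _) {Hk}.
  by move: (x ^+ k) (y ^+ k) (x ^+ n) (y ^+ n) => *; ring.
by rewrite Hk mulr0.
Qed.

Lemma loc_leftB u v : loc_left (u - v) = loc_left u - loc_left v.
Proof.
rewrite -[u]fracK -[v]fracK fracN fracD !loc_left_frac fracN fracD.
rewrite exprD !exprMn; congr frac.
move: (num _) (num _) (x ^+ _) (x ^+ _) (y ^+ _) (y ^+ _) => *; ring.
Qed.

Lemma loc_rightB u v : loc_right (u - v) = loc_right u - loc_right v.
Proof.
rewrite -[u]fracK -[v]fracK fracN fracD !loc_right_frac fracN fracD.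
rewrite exprD !exprMn; congr frac.
move: (num _) (num _) (x ^+ _) (x ^+ _) (y ^+ _) (y ^+ _) => *; ring.
Qed.

Definition cech_boundary (uv : loc x * loc y) : loc (x * y) :=
  loc_right uv.2 - loc_left uv.1.

Definition cech_image : {pred loc (x * y)} :=
  fun w => `[< range cech_boundary w >].

Let cech_image_zmod : zmod_closed cech_image.
Proof.
split=> [|_ _ /asboolP[[u v] _ <-] /asboolP[[u' v'] _ <-]]; apply/asboolP.
  exists (0, 0) => //; rewrite /cech_boundary /=.
  by rewrite -[X in loc_right X](subrr 0) -[X in loc_left X](subrr 0)
    loc_rightB loc_leftB !subrr.
exists (u - u', v - v') => //.
rewrite /cech_boundary /= loc_rightB loc_leftB !opprB addrACA [RHS]addrACA.
by congr (_ + _); rewrite addrC.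
Qed.

HB.instance Definition _ :=
  GRing.isZmodClosed.Build (loc (x * y)) cech_image cech_image_zmod.

Definition lc2 : Type := Quotient.quot cech_image.

HB.instance Definition _ := GRing.Zmodule.on lc2.

Definition lc2_class (w : loc (x * y)) : lc2 := \pi_(Quotient.quot cech_image) w.

Lemma lc2_class_eq0 w : lc2_class w = 0 <-> range cech_boundary w.
Proof.
have E0 : \pi_(Quotient.quot cech_image) 0 = 0 :> lc2 by exact: raddf0.
have E : (w - 0 \in cech_image) = (lc2_class w == 0).
  by rewrite Quotient.idealrBE E0.
rewrite subr0 in E; split=> [/eqP|Hw]; first by rewrite -E => /asboolP.
by apply/eqP; rewrite -E; apply/asboolP.
Qed.

(** [H d] stands for the set of the homogeneous elements of [S] of degree [d],
    and [dxy] for the degree of [x * y]. The fraction [z / (x y)^k] has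
    degree [d] when [z] has degree [d + k dxy]. *)
Definition lc2_component (H : bideg -> set S) (dxy d : bideg) : set lc2 :=
  [set c | exists k z, H (d + dxy *+ k) z /\ c = lc2_class (frac (x * y) z k)].

End LocalCohomology.

Definition rees_lc2 (R : comNzRingType) (I J : set R) (a b : R) (d : bideg) :
    set (lc2 (rees_t1 I J a) (rees_t2 I J b)) :=
  lc2_component (@rees_homog R I J) (1, 1) d.
Arguments rees_lc2 {R} I J a b d.

(* Main.v *)
(** Put [F(r,s) = I^r J^s], [Q = a^k F(r,s+l) + b^l F(r+k,s)] and
    [K = (F(r+k,s) : a^k) ∩ (F(r,s+l) : b^l)]. As [R] is Cohen-Macaulay, [a^k, b^l] is a
    regular sequence, and its Koszul relations give
    [l(R/Q) + l(R/K) = k l l(R/(a,b)) + l(R/F(r,s+l)) + l(R/F(r+k,s))]. For large [k] and [l]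
    this makes [l(F(r+k,s+l)/Q) - l(K/F(r,s))] a polynomial in [k] and [l] with
    coefficients in the Hilbert coefficients; it vanishes when [(r,s)] is large, which
    yields [e_(1,1) = l(R/(a,b))], [e_(2,0) = e_0(I)] and [e_(0,2) = e_0(J)], and leaves a
    polynomial of degree one for every [(r,s)]. At [(r0,s0)] the hypotheses on
    [(a)] and [(b)] give [K = F(r0,s0)], so this polynomial is nonnegative; if another joint
    reduction has reduction vector [(r0,s0)], it gives [Q = F(r0+k,s0+l)] and makes the same
    polynomial nonpositive, hence zero. This is (a) => (b). Under (b), [Q = F(r0+k,s0+l)]
    for large [k], which kills the direct limit [H^2] of the [F(r0+k,s0+k)/Q]; and the
    hypotheses on [(a)] and [(b)] make the maps of this system injective, so that (c)
    gives [F(r0+1,s0+1) = a F(r0,s0+1) + b F(r0+1,s0)]. *)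

Require Import Defs.
From mathcomp Require Import all_boot all_order all_algebra ring zify.
From mathcomp Require Import finmap monalg.
From mathcomp Require Import boolp classical_sets.

Set Implicit Arguments.
Unset Strict Implicit.
Unset Printing Implicit Defensive.

Import GRing.Theory.

Local Open Scope classical_set_scope.
Local Open Scope ring_scope.

(** * Closure properties of ideals given as sets *)

Section Ideals.
Variable R : comNzRingType.
Implicit Types (K L M N : set R) (c x y : R).

Lemma ideal0 K : is_ideal K -> K 0. Proof. by case. Qed.

Lemma ideal_add K x y : is_ideal K -> K x -> K y -> K (x + y).
Proof. by case=> _ + _; apply. Qed.

Lemma ideal_mull K c x : is_ideal K -> K x -> K (c * x).
Proof. by case=> _ _; apply. Qed.

Lemma ideal_mulr K c x : is_ideal K -> K x -> K (x * c).
Proof. by rewrite mulrC; apply: ideal_mull. Qed.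

Lemma ideal_sub K x y : is_ideal K -> K x -> K y -> K (x - y).
Proof.
by move=> Ki Kx Ky; apply: ideal_add => //; rewrite -mulN1r; apply: ideal_mull.
Qed.

Lemma idealT : is_ideal [set: R]. Proof. by split. Qed.

Lemma idealD_ideal K L : is_ideal K -> is_ideal L -> is_ideal (idealD K L).
Proof.
move=> Ki Li; split=> [|_ _ [x Kx [y Ly <-]] [x' Kx' [y' Ly' <-]]|c _ [x Kx [y Ly <-]]].
- by exists 0; [exact: ideal0|exists 0; [exact: ideal0|rewrite addr0]].
- exists (x + x'); first exact: ideal_add.
  by exists (y + y'); [exact: ideal_add|rewrite addrACA].
- by exists (c * x); [exact: ideal_mull|exists (c * y); [exact: ideal_mull|rewrite mulrDr]].
Qed.

Lemma scale_ideal_ideal c K : is_ideal K -> is_ideal (scale_ideal c K).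
Proof.
move=> Ki; split=> [|_ _ [x Kx <-] [y Ky <-]|d _ [x Kx <-]].
- by exists 0; [exact: ideal0|rewrite mulr0].
- by exists (x + y); [exact: ideal_add|rewrite mulrDr].
- by exists (d * x); [exact: ideal_mull|rewrite mulrCA].
Qed.

Lemma colon_ideal K c : is_ideal K -> is_ideal (colon K c).
Proof.
move=> Ki; split=> [|x y Hx Hy|d x Hx]; rewrite /colon /=.
- by rewrite mulr0; exact: ideal0.
- by rewrite mulrDr; exact: ideal_add.
- by rewrite mulrCA; exact: ideal_mull.
Qed.

Lemma setI_ideal K L : is_ideal K -> is_ideal L -> is_ideal (K `&` L).
Proof.
move=> Ki Li; split=> [|x y [Kx Lx] [Ky Ly]|c x [Kx Lx]].
- by split; exact: ideal0.
- by split; exact: ideal_add.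
- by split; exact: ideal_mull.
Qed.

Lemma ideal_gen1 c : ideal_gen [set c] = scale_ideal c setT.
Proof.
apply/seteqP; split.
  apply: smallest_sub; first by apply: scale_ideal_ideal.
  by move=> _ ->; exists 1 => //; rewrite mulr1.
move=> _ [x _ <-]; apply: (ideal_mulr _ (ideal_gen_ideal _)).
exact: sub_gen_smallest.
Qed.

End Ideals.

Create HintDb isideal.
#[local] Hint Resolve idealT idealD_ideal scale_ideal_ideal colon_ideal setI_ideal
  ideal_gen_ideal : isideal.
Ltac isideal := solve [auto 8 with isideal].

(** * Length of quotients, measured by strict chains of ideals *)

Section Length.
Variable R : comNzRingType.
Implicit Types (K L M N : set R) (c x y : R).

Lemma idealD_subl K L : is_ideal L -> K `<=` idealD K L.
Proof. by move=> Li x Kx; exists x => //; exists 0; [exact: ideal0|rewrite addr0]. Qed.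

Lemma idealD_subr K L : is_ideal K -> L `<=` idealD K L.
Proof. by move=> Ki x Lx; exists 0; [exact: ideal0|exists x; rewrite ?add0r]. Qed.

Lemma idealD_sub K L M : is_ideal M -> K `<=` M -> L `<=` M -> idealD K L `<=` M.
Proof. by move=> Mi KM LM _ [x Kx [y Ly <-]]; apply: ideal_add; auto. Qed.

Lemma idealDC K L : idealD K L = idealD L K.
Proof.
by apply/seteqP; split=> _ [x Kx [y Ly <-]]; exists y => //; exists x => //; rewrite addrC.
Qed.

Lemma scale_ideal_sub c K L : (forall x, K x -> L (c * x)) -> scale_ideal c K `<=` L.
Proof. by move=> KL _ [x Kx <-]; apply: KL. Qed.

Definition ideal_itv N M : set (set R) :=
  [set K | [/\ is_ideal K, N `<=` K & K `<=` M]].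

Lemma strict_chain_map (F F' : set (set R)) (phi : set R -> set R) k :
  (forall K, F K -> F' (phi K)) ->
  (forall K L, F K -> F L -> K `<` L -> phi K `<` phi L) ->
  strict_chain F k -> strict_chain F' k.
Proof.
move=> FF' mono [L [FL sL]]; exists (fun i => phi (L i)); split=> i ik.
  by apply: FF'; apply: FL.
by apply: mono; [apply: FL; lia|apply: FL; lia|apply: sL].
Qed.

(** Lengths are compared through their chains alone, so no isomorphism of modules is built and no
    finiteness is assumed: both sides take the default value [0] together. *)
Lemma eq_quo_length M N M' N' :
  (forall k, strict_chain (ideal_itv N M) k <-> strict_chain (ideal_itv N' M') k) ->
  quo_length M N = quo_length M' N'.
Proof.
move=> E; rewrite /quo_length; congr xget; apply/seteqP; split=> n [] /E Hn nmax; split=> // k /E.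
  exact: nmax.
exact: nmax.
Qed.

Lemma max_chain_lengthP (F : set (set R)) n :
  F !=set0 -> (forall k, strict_chain F k -> (k <= n)%N) ->
  exists p, max_chain_length F p.
Proof.
move=> [K FK] Fn.
have ex0 : exists k, `[< strict_chain F k >].
  by exists 0%N; apply/asboolP; exists (fun=> K); split.
have bnd k : `[< strict_chain F k >] -> (k <= n)%N by move/asboolP/Fn.
case: (ex_maxnP ex0 bnd) => p /asboolP Fp pmax; exists p; split=> // k Fk.
by apply: pmax; apply/asboolP.
Qed.

(** Finiteness has to be tracked separately, because [quo_length] is also [0] for an infinite
    length. *)
Definition finite_quo M N := exists n, max_chain_length (ideal_itv N M) n.

Lemma quo_lengthP M N : finite_quo M N ->
  max_chain_length (ideal_itv N M) (quo_length M N).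
Proof. by case=> n Hn; apply: xgetPex; exists n. Qed.

Lemma quo_lengthE M N n : max_chain_length (ideal_itv N M) n -> quo_length M N = n.
Proof.
move=> Hn; have [H1 H2] : max_chain_length (ideal_itv N M) (quo_length M N).
  by apply: quo_lengthP; exists n.
by case: Hn => H3 H4; apply/eqP; rewrite eqn_leq H2 // H4.
Qed.

Lemma strict_chain_sub (F F' : set (set R)) k :
  F `<=` F' -> strict_chain F k -> strict_chain F' k.
Proof. by move=> FF'; apply: (strict_chain_map (phi := id)). Qed.

Lemma strict_chain_rcons N M M' k :
  is_ideal M' -> N `<=` M -> M `<` M' ->
  strict_chain (ideal_itv N M) k -> strict_chain (ideal_itv N M') k.+1.
Proof.
move=> M'i NM [MM' M'M] [L [FL sL]]; exists (fun i => if (i <= k)%N then L i else M').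
split=> i ik.
  case: ifP => ik'; last by split=> //; apply: subset_trans MM'.
  by have [? ? LM] := FL _ ik'; split=> //; apply: subset_trans MM'.
have -> : (i <= k)%N by lia.
case: ifP => ik'; first exact: sL.
have [Li NL LM] := FL i ik; split; first exact: subset_trans MM'.
by move=> M'L; apply: M'M; apply: subset_trans LM.
Qed.

Lemma strict_chain_cat N L M p q :
  N `<=` L -> L `<=` M ->
  strict_chain (ideal_itv N L) p -> strict_chain (ideal_itv L M) q ->
  strict_chain (ideal_itv N M) (p + q).
Proof.
move=> NL LM [A [FA sA]] [B [FB sB]].
exists (fun i => if (i <= p)%N then A i else B (i - p)%N); split=> i ik.
  case: ifP => ip; first by have [? ? ?] := FA _ ip; split=> //; apply: subset_trans LM.
  by have [|? ? ?] := FB (i - p)%N; [lia|split=> //; apply: subset_trans NL _].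
case: ifP => ip; case: ifP => ip'; try lia; first by apply: sA; lia.
  have -> : i = p by lia.
  have [//|_ _ AL] := FA p; have [|_ LB _] := FB 0%N; first lia.
  have [|BB BB'] := sB 0%N; first lia.
  have AB : A p `<=` B 0%N by apply: subset_trans LB.
  have -> : (p.+1 - p)%N = 1%N by lia.
  split; first exact: subset_trans BB.
  by move=> BA; apply: BB'; apply: subset_trans AB.
have -> : (i.+1 - p)%N = (i - p).+1 by lia.
by apply: sB; lia.
Qed.

(* Dedekind's modular law: a strict inclusion stays strict in the sum with [L]
   or in the intersection with [L]. *)
Lemma strict_chain_split N L M k :
  is_ideal N -> is_ideal L -> is_ideal M -> N `<=` L -> L `<=` M ->
  strict_chain (ideal_itv N M) k ->
  exists p q, [/\ (k <= p + q)%N, strict_chain (ideal_itv N L) p &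
                  strict_chain (ideal_itv L M) q].
Proof.
move=> Ni Li Mi NL LM [A [FA sA]].
suff H i : (i <= k)%N -> exists p q, [/\ (i <= p + q)%N,
    strict_chain (ideal_itv N (A i `&` L)) p &
    strict_chain (ideal_itv L (idealD (A i) L)) q].
  have [//|p [q [kpq Hp Hq]]] := H k; have [//|Ai NA AM] := FA k; exists p, q; split=> //.
    by apply: strict_chain_sub Hp => K [? ? KL]; split=> // x /KL[].
  apply: strict_chain_sub Hq => K [? ? KL]; split=> // x /KL.
  by apply: idealD_sub.
elim: i => [|i IH] ik.
  have [//|Ai NA AM] := FA 0%N; exists 0%N, 0%N; split=> //.
    by exists (fun=> N); split=> // j _; split=> // x Nx; split; auto.
  by exists (fun=> L); split=> // j _; split=> //; apply: idealD_subr.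
have [|p [q [ipq Hp Hq]]] := IH; first lia.
have [|Ai NA AM] := FA i; first lia.
have [//|Ai' NA' AM'] := FA i.+1.
have [//|AA AA'] := sA i.
have DD : idealD (A i) L `<=` idealD (A i.+1) L.
  by apply: idealD_sub; [exact: idealD_ideal|apply: subset_trans (idealD_subl _)|
    exact: idealD_subr].
have II : A i `&` L `<=` A i.+1 `&` L by move=> x [/AA ? ?].
have [IE|IE] := pselect (A i.+1 `&` L `<=` A i `&` L); last first.
  exists p.+1, q; split; [lia| |].
    apply: strict_chain_rcons Hp => //; first exact: setI_ideal.
    by move=> x Nx; split; auto.
  by apply: strict_chain_sub Hq => K [? ? KL]; split=> //; apply: subset_trans DD.
have [DE|DE] := pselect (idealD (A i.+1) L `<=` idealD (A i) L).
  case: AA' => x Ax; have [|y Ay [z Lz xE]] := DE x; first exact: idealD_subl.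
  have [|Az _] := IE z; last by rewrite -xE; apply: ideal_add.
  by split=> //; rewrite -(addKr y z) xE addrC; apply: ideal_sub => //; apply: AA.
exists p, q.+1; split; [lia| |].
  by apply: strict_chain_sub Hp => K [? ? KL]; split=> //; apply: subset_trans II.
apply: strict_chain_rcons Hq => //; first exact: idealD_ideal.
exact: idealD_subr.
Qed.

(** Additivity of length: gluing two chains at [L] gives one inequality, splitting a chain along [L]
    gives the other. *)
Lemma max_chain_length_cat N L M p q :
  is_ideal N -> is_ideal L -> is_ideal M -> N `<=` L -> L `<=` M ->
  max_chain_length (ideal_itv N L) p -> max_chain_length (ideal_itv L M) q ->
  max_chain_length (ideal_itv N M) (p + q).
Proof.
move=> Ni Li Mi NL LM [Hp pmax] [Hq qmax]; split; first exact: strict_chain_cat Hp Hq.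
move=> k /(strict_chain_split Ni Li Mi NL LM) [p' [q' [kpq /pmax ? /qmax ?]]]; lia.
Qed.

Lemma finite_quo_sub N N' M M' :
  is_ideal N' -> N `<=` N' -> N' `<=` M' -> M' `<=` M ->
  finite_quo M N -> finite_quo M' N'.
Proof.
move=> N'i NN NM MM [n [_ nmax]]; apply: (@max_chain_lengthP _ n); first by exists N'; split.
move=> k Hk; apply: nmax; apply: strict_chain_sub Hk => K [? ? ?]; split=> //.
  exact: subset_trans NN _.
exact: subset_trans MM.
Qed.

Lemma quo_lengthD N L M :
  is_ideal N -> is_ideal L -> is_ideal M -> N `<=` L -> L `<=` M ->
  finite_quo setT N -> quo_length M N = (quo_length M L + quo_length L N)%N.
Proof.
move=> Ni Li Mi NL LM fN; rewrite addnC; apply: quo_lengthE.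
apply: (max_chain_length_cat Ni Li Mi) => //; apply: quo_lengthP; apply: finite_quo_sub fN => //.
Qed.

Lemma quo_lengthxx N : is_ideal N -> quo_length N N = 0%N.
Proof.
move=> Ni; apply: quo_lengthE; split.
  by exists (fun=> N); split=> // i _; split.
case=> // k [L [FL sL]]; have [//|_ []] := sL 0%N.
have [//|_ _ H1] := FL 1%N; have [//|_ H0 _] := FL 0%N.
exact: subset_trans H1 H0.
Qed.

Lemma quo_length_eq0 N M : is_ideal N -> is_ideal M -> N `<=` M ->
  finite_quo setT N -> quo_length M N = 0%N -> M = N.
Proof.
move=> Ni Mi NM fN E; have [|_ lmax] := @quo_lengthP M N.
  exact: finite_quo_sub fN.
apply/seteqP; split=> //; apply: contrapT => MN.
suff /lmax : strict_chain (ideal_itv N M) 1 by rewrite E.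
exists (fun i => if i is 0%N then N else M); split=> -[|i] //= _; split=> //.
Qed.

(** Multiplication by [c] induces an isomorphism from [M / (M ∩ (N : c))] to [(cM + N) / N]. On
    submodules it is [K ↦ cK + N], with inverse [K ↦ M ∩ (K : c)]; both maps are strictly
    monotone. *)
Lemma strict_chain_scale c M N k : is_ideal M -> is_ideal N ->
  strict_chain (ideal_itv N (idealD (scale_ideal c M) N)) k <->
  strict_chain (ideal_itv (M `&` colon N c) M) k.
Proof.
move=> Mi Ni; split.
  apply: (strict_chain_map (phi := fun K => M `&` colon K c)).
    move=> K [Ki NK KM]; split; first isideal.
      by move=> x [Mx /NK].
    by move=> x [].
  move=> K L [Ki NK KM] [Li NL LM] [KL LK]; split; first by move=> x [Mx /KL].
  move=> H; apply: LK => y Ly; have [_ [x Mx <-] [n Nn yE]] := LM _ Ly.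
  have [|_ Kx] := H x; last by rewrite -yE; apply: ideal_add; auto.
  split=> //; rewrite /colon /= -(addrK n (c * x)) yE.
  by apply: ideal_sub => //; apply: NL.
apply: (strict_chain_map (phi := fun K => idealD (scale_ideal c K) N)).
  move=> K [Ki NK KM]; split.
  - isideal.
  - by apply: idealD_subr; isideal.
  - by move=> _ [_ [x Kx <-] [n Nn <-]]; exists (c * x); [exists x; auto|exists n].
move=> K L [Ki NK KM] [Li NL LM] [KL LK]; split.
  by move=> _ [_ [x Kx <-] [n Nn <-]]; exists (c * x); [exists x; auto|exists n].
move=> H; apply: LK => y Ly.
have [|_ [x Kx <-] [n Nn E]] := H (c * y).
  by exists (c * y); [exists y|exists 0; [exact: ideal0|rewrite addr0]].
rewrite -(subrK x y); apply: ideal_add => //; apply: NK; split.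
  by apply: ideal_sub => //; apply: LM => //; apply: KL.
by rewrite /colon /= mulrBr -E addrAC subrr add0r.
Qed.

Lemma quo_length_scale c M N : is_ideal M -> is_ideal N ->
  quo_length (idealD (scale_ideal c M) N) N = quo_length M (M `&` colon N c).
Proof. by move=> Mi Ni; apply: eq_quo_length => k; apply: strict_chain_scale. Qed.

Lemma colength_scale c N : is_ideal N ->
  quo_length (idealD (scale_ideal c setT) N) N = colength (colon N c).
Proof. by move=> Ni; rewrite quo_length_scale ?setTI //; exact: idealT. Qed.

End Length.

(** * Chain conditions, finite colength and Nakayama-type arguments *)

Section Noetherian.
Variable R : comNzRingType.
Implicit Types (K L m : set R) (a b c x y z : R).

Lemma noetherian_stationary (L : nat -> set R) :
  noetherian R -> (forall n, is_ideal (L n)) -> (forall n, L n `<=` L n.+1) ->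
  exists N, forall n, (N <= n)%N -> L n = L N.
Proof.
move=> noeth Li Lsub.
have Lle i j : (i <= j)%N -> L i `<=` L j.
  move=> /subnK <-; elim: (j - i)%N => // k IH; apply: subset_trans (Lsub _).
  exact: IH.
have Ui : is_ideal (\bigcup_n L n).
  split=> [|x y [i _ Lx] [j _ Ly]|c x [i _ Lx]].
  - by exists 0%N => //; apply: ideal0.
  - exists (maxn i j) => //; apply: ideal_add => //.
      by apply: (Lle i) => //; lia.
    by apply: (Lle j) => //; lia.
  - by exists i => //; apply: ideal_mull.
have [s sE] := noeth _ Ui.
have sU x : x \in s -> exists n, L n x.
  move=> xs; have : (\bigcup_n L n) x by rewrite sE; apply: sub_gen_smallest.
  by case=> n _ ?; exists n.
have [N sN] : exists N, forall x, x \in s -> L N x.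
  elim: s {sE} sU => [|x s IH] sU; first by exists 0%N.
  have [|N sN] := IH; first by move=> y ys; apply: sU; rewrite inE ys orbT.
  have [n Lx] := sU x (mem_head _ _).
  exists (maxn n N) => y; rewrite inE => /orP[/eqP->|/sN Ly].
    by apply: (Lle n) => //; lia.
  by apply: (Lle N) => //; lia.
exists N => n Nn; apply/seteqP; split; last exact: Lle.
move=> x Lx; have : (\bigcup_n L n) x by exists n.
by rewrite sE; apply: smallest_sub.
Qed.

Lemma noetherian_maximal (F : set (set R)) :
  noetherian R -> F !=set0 -> F `<=` @is_ideal R ->
  exists2 K, F K & forall L, F L -> K `<=` L -> L = K.
Proof.
move=> noeth [K0 FK0] Fi; apply: contrapT => nomax.
(* The hypothesis [F K] stands under the existential so that [choice] yields a function defined on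
   all sets. *)
have next K : exists L, F K -> [/\ F L, K `<=` L & L <> K].
  apply: contrapT => H; have FK : F K.
    by apply: contrapT => nFK; apply: H; exists K.
  apply: nomax; exists K => // L FL KL; apply: contrapT => LK.
  by apply: H; exists L.
have [f fP] := choice next.
have FL n : F (iter n f K0) by elim: n => //= n /fP[].
have [n||N HN] := noetherian_stationary noeth (L := fun n => iter n f K0).
- exact: Fi.
- by move=> n; have [] := fP _ (FL n).
by have [_ _] := fP _ (FL N); apply; apply: (HN N.+1).
Qed.

Lemma maximal_ideal_itv m k : maximal_ideal m ->
  strict_chain (ideal_itv m setT) k -> (k <= 1)%N.
Proof.
case=> mi m1 mmax [L [FL sL]]; apply: contrapT => k1.
have [|L1i mL1 _] := FL 1%N; first lia.
have [|_ mL0 _] := FL 0%N; first lia.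
have [|_ L10] := sL 0%N; first lia.
have [|_ L21] := sL 1%N; first lia.
have [E|E] := mmax _ L1i mL1.
  by apply: L10; rewrite E.
by apply: L21; rewrite E.
Qed.

(* Noetherian induction: if [K : z] is maximal among the [K : z] with [z] not in
   [K], it is [m], so that [(K + (z)) / K] is simple. *)
Lemma finite_colength m K : noetherian R -> maximal_ideal m ->
  is_ideal K -> m `<=` radical K -> finite_quo setT K.
Proof.
move=> noeth mmax Ki mK; apply: contrapT => Kinf.
pose F := [set L | [/\ is_ideal L, m `<=` radical L & ~ finite_quo setT L]].
have [||{K Ki mK Kinf} K [Ki mK Kinf] Kmax] := @noetherian_maximal F noeth.
- by exists K.
- by move=> L [].
have K1 : ~ K 1.
  move=> K1; apply: Kinf; have -> : K = setT.
    by apply/seteqP; split=> // x _; rewrite -[x]mulr1; apply: ideal_mull.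
  exists 0%N; split; first by exists (fun=> setT); split=> // i _; split.
  case=> // k [L [FL sL]]; have [//|_ H] := sL 0%N; have [//|_ H' _] := FL 0%N.
  by case: H => x _; apply: H'.
pose G := [set L | exists2 z, ~ K z & L = colon K z].
have [||_ [z Kz ->] zmax] := @noetherian_maximal G noeth.
- by exists (colon K 1), 1.
- by move=> _ [z _ ->]; isideal.
have mz : m `<=` colon K z.
  move=> y my; have [n Kyn] := mK _ my; rewrite /colon /= mulrC.
  have {Kyn}: K (y ^+ n.+1 * z).
    by apply: ideal_mulr => //; rewrite exprS; apply: ideal_mull.
  elim: n => [|n IH]; first by rewrite expr1.
  have [|Kyz] := pselect (K (y * z)); first by [].
  rewrite exprSr -mulrA => Hn; apply: IH.
  (* If [y z] is not in [K], then [(K : y z)] belongs to [G] and contains the maximal member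
     [(K : z)]; this removes one factor [y] from the power. *)
  have E : colon K (y * z) = colon K z.
    apply: zmax; first by exists (y * z).
    by move=> x Kx; rewrite /colon /= -mulrA; apply: ideal_mull.
  have : colon K (y * z) (y ^+ n.+1) by rewrite /colon /= mulrC.
  by rewrite E /colon /= mulrC.
have zm : colon K z = m.
  have [_ _ /(_ _ (colon_ideal z Ki) mz)[//|zT]] := mmax.
  by have : colon K z 1; [rewrite zT|rewrite /colon /= mulr1].
pose L := idealD (scale_ideal z setT) K.
have Li : is_ideal L by rewrite /L; isideal.
have KL : K `<=` L by apply: idealD_subr; isideal.
(* [L] contains [z], hence is strictly larger than [K], which is maximal among the ideals of
   infinite colength. *)
have fL : finite_quo setT L.
  apply: contrapT => Linf; have /Kmax : F L.
    split=> // x mx; have [n Kn] := mK _ mx; exists n; exact: KL.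
  move=> /(_ KL) LK; apply: Kz; rewrite -LK; apply: idealD_subl => //.
  by exists 1; rewrite ?mulr1.
(* [L / K] is isomorphic to [R / (K : z) = R / m], which is simple. *)
have [p Hp] : finite_quo L K.
  apply: (@max_chain_lengthP _ _ 1); first by exists K; split.
  move=> k /(strict_chain_scale _ _ (idealT _) Ki); rewrite setTI zm.
  exact: maximal_ideal_itv.
case: fL => q Hq; apply: Kinf; exists (p + q)%N.
by apply: max_chain_length_cat Hp Hq => //; exact: idealT.
Qed.

(** The element [1 - x] is a unit: otherwise an ideal maximal among the proper ideals containing it
    would be [m], and [m] would contain [1]. *)
Lemma local_unit m x y : noetherian R -> local_ring m -> m x ->
  (1 - x) * y = 0 -> y = 0.
Proof.
move=> noeth [mmax muniq] mx xy.
have [[u _ Eu]|nu] := pselect (scale_ideal (1 - x) setT 1).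
  by rewrite -[y]mul1r -Eu mulrAC xy mul0r.
pose F := [set L | [/\ is_ideal L, scale_ideal (1 - x) setT `<=` L & ~ L 1]].
have [||n [ni xn n1] nmax] := @noetherian_maximal F noeth.
- by exists (scale_ideal (1 - x) setT); split=> //; isideal.
- by move=> L [].
have nm : n = m.
  apply: muniq; split=> // L Li nL; have [L1|L1] := pselect (L 1).
    by right; apply/seteqP; split=> // z _; rewrite -[z]mulr1; apply: ideal_mull.
  by left; apply: nmax => //; split=> //; apply: subset_trans nL.
case: n1; rewrite -(subrK x 1); apply: ideal_add => //; last by rewrite nm.
by apply: xn; exists 1; rewrite ?mulr1.
Qed.

(* If [b] divides every element of [ann a] within [ann a], then iterating the
   division gives an increasing chain of principal ideals. *)
Lemma annihilator_eq0 m a b p : noetherian R -> local_ring m -> m b ->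
  (forall q, a * q = 0 -> exists2 w, q = b * w & a * w = 0) ->
  a * p = 0 -> p = 0.
Proof.
move=> noeth mloc mb div ap.
have next q : exists w, a * q = 0 -> q = b * w /\ a * w = 0.
  have [/div[w]|?] := pselect (a * q = 0); first by exists w.
  by exists 0.
have [f fP] := choice next.
pose P n := iter n f p.
have aP n : a * P n = 0 by elim: n => //= n /fP[].
have PS n : P n = b * P n.+1 by have [] := fP _ (aP n).
have [n|n|N HN] := noetherian_stationary noeth (L := fun n => scale_ideal (P n) setT).
- by isideal.
- by apply: scale_ideal_sub => x _; exists (b * x) => //; rewrite (PS n); ring.
(* Stationarity gives [P N.+1 = c * P N = c * b * P N.+1], and [1 - c * b] is a unit because [b]
   lies in [m]. *)
have [c _ Ec] : scale_ideal (P N) setT (P N.+1).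
  by rewrite -(HN N.+1) //; exists 1; rewrite ?mulr1.
have PN : P N.+1 = 0.
  have mi : is_ideal m by case: mloc => [[]].
  apply: (@local_unit m (c * b)) => //; first exact: ideal_mull.
  by rewrite mulrBl mul1r -{1}Ec (PS N); ring.
have : P 0%N = b ^+ N.+1 * P N.+1.
  elim: (N.+1) => [|k IH]; first by rewrite mul1r.
  by rewrite IH (PS k) exprSr mulrA.
by rewrite PN mulr0.
Qed.

End Noetherian.

(** * Regular sequences of length two and Koszul relations *)

Section RegularPairs.
Variable R : comNzRingType.
Implicit Types (K m : set R) (a b c x y z : R).

Definition ideal2 a b : set R := idealD (scale_ideal a setT) (scale_ideal b setT).

Definition nonzerodiv a := forall p, a * p = 0 -> p = 0.

(** Exactness of the Koszul complex of [(a, b)] in its middle term: every syzygy is trivial. Unlike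
    the usual definition of a regular sequence, this condition is visibly symmetric in [a] and
    [b]. *)
Definition koszul_exact a b :=
  forall p q, a * p = b * q -> exists w, p = b * w /\ q = a * w.

Lemma ideal2P a b z : ideal2 a b z <-> exists u v, z = a * u + b * v.
Proof.
split=> [[_ [u _ <-] [_ [v _ <-] <-]]|[u [v ->]]]; first by exists u, v.
by exists (a * u); [exists u|exists (b * v); [exists v|]].
Qed.

Lemma ideal2_ideal a b : is_ideal (ideal2 a b).
Proof. by rewrite /ideal2; isideal. Qed.

Lemma ideal2C a b : ideal2 a b = ideal2 b a. Proof. exact: idealDC. Qed.

Lemma koszul_exactC a b : koszul_exact a b -> koszul_exact b a.
Proof. by move=> ab p q /esym /ab[w [-> ->]]; exists w. Qed.

Lemma koszul_exactM a a' b :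
  koszul_exact a b -> koszul_exact a' b -> koszul_exact (a * a') b.
Proof.
move=> ab a'b p q; rewrite -mulrA => /ab[w [/a'b[w' [-> ->]] ->]].
by exists w'; rewrite mulrA.
Qed.

Lemma koszul_exactX a b k l : koszul_exact a b -> koszul_exact (a ^+ k) (b ^+ l).
Proof.
have X a' b' n : koszul_exact a' b' -> koszul_exact (a' ^+ n) b'.
  move=> ab; elim: n => [|n IH]; last by rewrite exprS; apply: koszul_exactM.
  by move=> p q; rewrite !mul1r => ->; exists q; rewrite mul1r.
by move=> ab; apply/X/koszul_exactC/X/koszul_exactC.
Qed.

Lemma nonzerodivX a n : nonzerodiv a -> nonzerodiv (a ^+ n).
Proof.
move=> aP; elim: n => [|n IH] p; first by rewrite mul1r.
by rewrite exprS -mulrA => /aP/IH.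
Qed.

Lemma nonzerodivM a b : nonzerodiv a -> nonzerodiv b -> nonzerodiv (a * b).
Proof. by move=> aP bP p; rewrite -mulrA => /aP/bP. Qed.

Lemma nonzerodivI a p q : nonzerodiv a -> a * p = a * q -> p = q.
Proof. by move=> aP /eqP; rewrite -subr_eq0 -mulrBr => /eqP/aP/eqP; rewrite subr_eq0 => /eqP. Qed.

(* Write [x = a c + b d]. If [a p = b q] and [t = c q + d p], then [x p = b t],
   [x q = a t] and [y t] lies in [(x)], so that [t = x w]. *)
Lemma koszul_exact_grade2 a b x y : ideal2 a b x -> ideal2 a b y ->
  nonzerodiv x -> (forall t u, y * t = x * u -> exists w, t = x * w) ->
  koszul_exact a b.
Proof.
move=> /ideal2P[c [d xE]] /ideal2P[c' [d' yE]] xP yP p q pq.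
have xp : x * p = b * (c * q + d * p).
  by transitivity (c * (a * p) + d * b * p); [rewrite xE|rewrite pq]; ring.
have xq : x * q = a * (c * q + d * p).
  by transitivity (c * a * q + d * (b * q)); [rewrite xE|rewrite -pq]; ring.
have [|w tE] := yP (c * q + d * p) (c' * q + d' * p).
  by transitivity (c' * (x * q) + d' * (x * p)); [rewrite xp xq yE|]; ring.
exists w; split; apply: (nonzerodivI xP).
  by rewrite xp tE mulrCA.
by rewrite xq tE mulrCA.
Qed.

(** If [a q = 0 = b 0], exactness writes [q = b w] with [a w = 0]. So the annihilator of [a] equals
    [b] times itself and vanishes. *)
Lemma koszul_exact_nonzerodiv m a b : noetherian R -> local_ring m -> m b ->
  koszul_exact a b -> nonzerodiv a.
Proof.
move=> noeth mloc mb ab p; apply: (annihilator_eq0 noeth mloc mb) => q aq.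
have [|w [qE aw]] := ab q 0; first by rewrite aq mulr0.
by exists w.
Qed.

(** Induction on [n]: regularity modulo [x] makes [t] divisible by [x], and cancelling this factor
    lowers the exponent. *)
Lemma regular_mod_pow x y n : nonzerodiv x ->
  (forall t u, y * t = x * u -> exists w, t = x * w) ->
  forall t u, y * t = x ^+ n * u -> exists w, t = x ^+ n * w.
Proof.
move=> xP yP; elim: n => [|n IH] t u; first by exists t; rewrite mul1r.
rewrite exprS -mulrA => ytE; have [t' tE] := yP _ _ ytE; move: ytE.
rewrite {}tE mulrCA => /(nonzerodivI xP) /IH[w ->].
by exists w; rewrite mulrA.
Qed.

Lemma regular_pow_mod x y n :
  (forall t u, y * t = x * u -> exists w, t = x * w) ->
  forall t u, y ^+ n * t = x * u -> exists w, t = x * w.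
Proof.
move=> yP; elim: n => [|n IH] t u; first by rewrite mul1r; exists u.
by rewrite exprSr -mulrA => /IH[w /yP].
Qed.

(** Turns a regular sequence of length [depth = dim = 2] into divisibility statements: the empty
    prefix generates the zero ideal, the prefix [[:: x]] the principal ideal of [x]. *)
Lemma cohen_macaulay_dim2_regular m : cohen_macaulay_local m -> krull_dim R 2 ->
  exists x y, [/\ m x, m y, nonzerodiv x &
    forall t u, y * t = x * u -> exists w, t = x * w].
Proof.
move=> [_ _ [d [dch dmax] [[s [[_ sreg] sm] sd] _]]] [ch2 max2].
have d2 : d = 2 by apply/eqP; rewrite eqn_leq max2 // dmax.
move: s sd sreg sm; rewrite d2; case=> [|x [|y [|]]] // _ sreg sm.
have gen0 : ideal_gen [set` [::]] `<=` [set (0 : R)].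
  apply: smallest_sub; last by move=> z; rewrite /= in_nil.
  by split=> // [u v -> ->|c u ->]; rewrite ?addr0 ?mulr0.
have gen1 : ideal_gen [set` [:: x]] = scale_ideal x setT.
  rewrite -ideal_gen1; congr ideal_gen; apply/seteqP; split=> z /=; rewrite inE.
    by move/eqP.
  by move=> ->.
exists x, y; split.
- by apply: sm; rewrite /= mem_head.
- by apply: sm; rewrite /= !inE eqxx orbT.
- move=> p xp; apply: gen0; apply: (sreg 0%N) => //=; rewrite xp.
  exact: ideal0 (ideal_gen_ideal _).
move=> t u ytE; have := sreg 1%N isT t; rewrite /= gen1.
by case=> [|w _ <-]; [exists u|exists w].
Qed.

(** Powers of a regular sequence of [m] lie in [(a, b)] and are again regular, so [(a, b)] has grade
    two. *)
Lemma parameters_koszul_exact m a b : cohen_macaulay_local m -> krull_dim R 2 ->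
  m `<=` radical (ideal2 a b) -> koszul_exact a b.
Proof.
move=> CM dim2 mab.
have [x [y [mx my xP yP]]] := cohen_macaulay_dim2_regular CM dim2.
have [n abx] := mab _ mx; have [n' aby] := mab _ my.
apply: (koszul_exact_grade2 abx aby); first exact: nonzerodivX.
by apply: regular_mod_pow => //; apply: regular_pow_mod.
Qed.

End RegularPairs.

(** * Length formulas from Koszul exactness *)

Section KoszulLength.
Variable R : comNzRingType.
Implicit Types (G H : set R) (a b A B : R).

(** Filter by [Q <= Q1 = A G + (B) <= (A, B)]. Exactness gives [(Q1 : A) = G + (B)] and
    [(Q : B) = A (G : B) + H], so the two quotients are [R / (G + (B))] and [R / (A (G : B) + H)].
    The first is shorter than [R / G] by [l(R / (G : B))], the second shorter than [R / H] by
    [l((G : B) / K)], and these two defects add up to [l(R / K)]. *)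
Lemma colength_koszul A B G H : koszul_exact A B -> is_ideal G -> is_ideal H ->
  let Q := idealD (scale_ideal A G) (scale_ideal B H) in
  let K := colon H A `&` colon G B in
  finite_quo setT Q -> finite_quo setT G -> finite_quo setT H -> finite_quo setT K ->
  (colength Q + colength K = colength (ideal2 A B) + colength G + colength H)%N.
Proof.
move=> AB Gi Hi Q K fQ fG fH fK.
have Qi : is_ideal Q by rewrite /Q; isideal.
have Ki : is_ideal K by rewrite /K; isideal.
pose sB := scale_ideal B setT : set R.
have sBi : is_ideal sB by rewrite /sB; isideal.
pose Q1 := idealD (scale_ideal A G) sB.
have Q1i : is_ideal Q1 by rewrite /Q1; isideal.
have QQ1 : Q `<=` Q1.
  apply: idealD_sub => //; first exact: idealD_subl.
  by move=> _ [x _ <-]; apply: idealD_subr; [isideal|exists x].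
have Q1ab : Q1 `<=` ideal2 A B.
  apply: idealD_sub; first exact: ideal2_ideal.
    by move=> _ [x _ <-]; apply: idealD_subl; [isideal|exists x].
  by apply: idealD_subr; isideal.
have GBi : is_ideal (idealD G sB) by isideal.
have GcB : is_ideal (colon G B) by isideal.
have HGi : is_ideal (idealD (scale_ideal A (colon G B)) H) by isideal.
have E1 : quo_length (ideal2 A B) Q1 = colength (idealD G sB).
  have -> : ideal2 A B = idealD (scale_ideal A setT) Q1.
    apply/seteqP; split.
      apply: idealD_sub; [isideal|exact: idealD_subl|].
      by apply: subset_trans (@idealD_subr _ _ _ _); [apply: idealD_subr|]; isideal.
    apply: idealD_sub => //; [exact: ideal2_ideal|].
    by apply: idealD_subl; isideal.
  rewrite colength_scale //; congr colength; apply/seteqP; split=> x.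
    rewrite /colon /= => -[_ [g Gg <-] [_ [v _ <-] E]].
    have [|w [xE _]] := AB (x - g) v; first by rewrite mulrBr -E addrC addKr.
    by exists g => //; exists (B * w); [exists w|rewrite -xE addrC subrK].
  move=> [g Gg [_ [v _ <-] <-]]; rewrite /colon /= mulrDr.
  by exists (A * g); [exists g|exists (A * (B * v)) => //; exists (A * v) => //; ring].
have E2 : quo_length Q1 Q = colength (idealD (scale_ideal A (colon G B)) H).
  have -> : Q1 = idealD (scale_ideal B setT) Q.
    apply/seteqP; split.
      apply: idealD_sub; [isideal| |exact: idealD_subl].
      by apply: subset_trans (@idealD_subr _ _ _ _); [apply: idealD_subl|]; isideal.
    by apply: idealD_sub => //; apply: idealD_subr; isideal.
  rewrite colength_scale //; congr colength; apply/seteqP; split=> x.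
    rewrite /colon /= => -[_ [g Gg <-] [_ [h Hh <-] E]].
    have [|w [gE xE]] := AB g (x - h); first by rewrite mulrBr -E addrK.
    by exists (A * w); [exists w => //; rewrite /colon /= -gE|
      exists h => //; rewrite -xE subrK].
  move=> [_ [g Gg <-] [h Hh <-]]; rewrite /colon /= mulrDr.
  exists (A * (B * g)); first by exists (B * g).
  by exists (B * h); [exists h|congr (_ + _); ring].
have E3 := quo_length_scale A GcB Hi.
have E4 := colength_scale B Gi.
have fin (L L' : set R) : is_ideal L' -> L `<=` L' -> finite_quo setT L -> finite_quo setT L'.
  by move=> L'i LL'; apply: finite_quo_sub.
have := quo_lengthD Qi Q1i (@idealT R) QQ1 (@subsetT _ _) fQ.
have := quo_lengthD Q1i (ideal2_ideal A B) (@idealT R) Q1ab (@subsetT _ _) (fin _ _ Q1i QQ1 fQ).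
have := quo_lengthD Gi GBi (@idealT R) (@idealD_subl _ G _ sBi) (@subsetT _ _) fG.
have := quo_lengthD Hi HGi (@idealT R)
  (@idealD_subr _ _ H (scale_ideal_ideal A GcB)) (@subsetT _ _) fH.
have KG : K `<=` colon G B by move=> x [].
have := quo_lengthD Ki GcB (@idealT R) KG (@subsetT _ _) fK.
rewrite /colength in E1 E2 E3 E4 *.
rewrite E1 E2 E3 [idealD G sB]idealDC E4 [colon G B `&` _]setIC -/K.
lia.
Qed.

(** Exactness gives [((A A', B) : A) = (A', B)], hence [(A, B) / (A A', B)] is isomorphic to
    [R / (A', B)]. *)
Lemma colength_ideal2M A A' B : koszul_exact A B ->
  finite_quo setT (ideal2 (A * A') B) ->
  colength (ideal2 (A * A') B) = (colength (ideal2 A B) + colength (ideal2 A' B))%N.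
Proof.
move=> AB fin; have iAB := @ideal2_ideal R.
have sub : ideal2 (A * A') B `<=` ideal2 A B.
  by move=> _ /ideal2P[u [v ->]]; apply/ideal2P; exists (A' * u), v; rewrite mulrA.
rewrite /colength (quo_lengthD (iAB _ _) (iAB _ _) (@idealT R) sub (@subsetT _ _) fin).
congr addn.
have -> : ideal2 A B = idealD (scale_ideal A setT) (ideal2 (A * A') B).
  apply/seteqP; split; last first.
    by apply: idealD_sub => //; apply: idealD_subl; isideal.
  move=> _ /ideal2P[u [v ->]]; exists (A * u); first by exists u.
  by exists (B * v) => //; apply/ideal2P; exists 0, v; rewrite mulr0 add0r.
rewrite colength_scale //; congr quo_length; apply/seteqP; split=> x.
  rewrite /colon /= => /ideal2P[u [v E]]; apply/ideal2P.
  have [|w [xE _]] := AB (x - A' * u) v; first by rewrite mulrBr E mulrA addrC addKr.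
  by exists u, w; rewrite -xE addrC subrK.
move=> /ideal2P[u [v ->]]; apply/ideal2P; exists u, (A * v); ring.
Qed.

Lemma colength_ideal2X a b k l : koszul_exact a b ->
  (forall k l, finite_quo setT (ideal2 (a ^+ k) (b ^+ l))) ->
  colength (ideal2 (a ^+ k) (b ^+ l)) = (k * l * colength (ideal2 a b))%N.
Proof.
move=> ab fin.
have c1 (c : R) : colength (ideal2 1 c) = 0%N.
  have -> : ideal2 1 c = setT.
    by apply/seteqP; split=> // x _; apply/ideal2P; exists x, 0; ring.
  by apply: quo_lengthxx; exact: idealT.
have X j : colength (ideal2 (a ^+ j) b) = (j * colength (ideal2 a b))%N.
  elim: j => [|j IH]; first by rewrite c1.
  rewrite exprS colength_ideal2M // ?IH ?mulSn //.
  by rewrite -exprS -[b]expr1; exact: fin.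
elim: l => [|l IH]; first by rewrite ideal2C c1 muln0.
rewrite exprS ideal2C colength_ideal2M; first last.
- by rewrite -exprS ideal2C; exact: fin.
- by rewrite -[b]expr1; apply/koszul_exactC/koszul_exactX.
by rewrite ideal2C X [ideal2 _ (a ^+ k)]ideal2C IH; ring.
Qed.

End KoszulLength.

(** * Products of powers of [I] and [J], and propagation of the joint reduction equality *)

Section Powers.
Variables (R : comNzRingType) (I J : set R).
Implicit Types (K m : set R) (a b x y z : R) (r s k l n : nat).
Local Notation F := (IJpow I J).

Lemma IJpow_ideal r s : is_ideal (F r s). Proof. exact: ideal_gen_ideal. Qed.

Lemma IJpow_mul r s r' s' x y :
  F r s x -> F r' s' y -> F (r + r') (s + s') (x * y).
Proof. by move=> Fx Fy; have := @IJpowz_mul R I J r%:Z s%:Z r'%:Z s'%:Z x y Fx Fy. Qed.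

Lemma IJpow00 : F 0 0 1.
Proof. by rewrite -[1]mulr1; apply: idealM_mem. Qed.

Lemma IJpow10 x : I x -> F 1 0 x.
Proof. by move=> Ix; rewrite -[x]mulr1; apply: idealM_mem => //; rewrite -[x]mulr1; apply: idealM_mem. Qed.

Lemma IJpow01 x : J x -> F 0 1 x.
Proof. by move=> Jx; rewrite -[x]mul1r; apply: idealM_mem => //; rewrite -[x]mulr1; apply: idealM_mem. Qed.

Lemma IJpow_exp r s n x : F r s x -> F (n * r) (n * s) (x ^+ n).
Proof.
move=> Fx; elim: n => [|n IH]; first exact: IJpow00.
by rewrite exprS !mulSn; apply: IJpow_mul.
Qed.

Lemma IJpow_mul_expl a r s k x : I a -> F r s x -> F (r + k) s (a ^+ k * x).
Proof.
move=> Ia Fx; have := IJpow_mul (IJpow_exp (n := k) (IJpow10 Ia)) Fx.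
by rewrite muln1 muln0 add0n addnC.
Qed.

Lemma IJpow_mul_expr b r s k x : J b -> F r s x -> F r (s + k) (b ^+ k * x).
Proof.
move=> Jb Fx; have := IJpow_mul (IJpow_exp (n := k) (IJpow01 Jb)) Fx.
by rewrite muln1 muln0 add0n addnC.
Qed.

(** An inclusion of [F r.+1 s] need only be tested on products from [I] and [F r s]; this drives the
    inductions on exponents below. *)
Lemma IJpowSl_sub r s K : is_ideal K ->
  (forall x y, I x -> F r s y -> K (x * y)) -> F r.+1 s `<=` K.
Proof.
move=> Ki IK; apply: idealM_sub => // x y Ix Jy.
suff : idealX I r.+1 `<=` colon K y by move=> /(_ _ Ix); rewrite /colon /= mulrC.
apply: idealM_sub; first isideal.
move=> x' x'' Ix' Ix''; rewrite /colon /= mulrC -mulrA.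
by apply: IK => //; apply: idealM_mem.
Qed.

Lemma IJpowSr_sub r s K : is_ideal K ->
  (forall x y, J x -> F r s y -> K (x * y)) -> F r s.+1 `<=` K.
Proof.
move=> Ki JK; apply: idealM_sub => // x y Ix Jy.
suff : idealX J s.+1 `<=` colon K x by apply.
apply: idealM_sub; first isideal.
move=> y' y'' Jy' Jy''; rewrite /colon /= mulrCA.
by apply: JK => //; apply: idealM_mem.
Qed.

(** Places the Hilbert function of [I J] on the diagonal of the bigraded one. *)
Lemma idealX_idealM n : idealX (idealM I J) n = F n n.
Proof.
apply/seteqP; split.
  elim: n => [|n IH]; first 
    by move=> x _; rewrite -[x]mulr1; apply: (ideal_mull _ (IJpow_ideal _ _)); exact: IJpow00.
  apply: idealM_sub; first exact: IJpow_ideal.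
  move=> x y IJx /IH Fy; rewrite -[n.+1]addn1 addnC; apply: IJpow_mul => //.
  move: x IJx; apply: idealM_sub; first exact: IJpow_ideal.
  by move=> x y' Ix Jy; exact: IJpow_mul (IJpow10 Ix) (IJpow01 Jy).
elim: n => [|n IH]; first by move=> x.
apply: IJpowSl_sub; first exact: idealX_ideal.
move=> x y Ix; suff : F n n.+1 `<=` colon (idealX (idealM I J) n.+1) x by apply.
apply: IJpowSr_sub; first exact/colon_ideal/idealX_ideal.
move=> x' y' Jx' /IH Fy'; rewrite /colon /= mulrA.
by apply: idealM_mem => //; apply: idealM_mem.
Qed.

(** [jr_ideal] and [jr_colon] are the ideals [Q] and [K] of the opening description. *)
Definition jr_ideal a b r s k l : set R :=
  idealD (scale_ideal (a ^+ k) (F r (s + l))) (scale_ideal (b ^+ l) (F (r + k) s)).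

Definition jr_colon a b r s k l : set R :=
  colon (F (r + k) s) (a ^+ k) `&` colon (F r (s + l)) (b ^+ l).

Lemma jr_ideal_ideal a b r s k l : is_ideal (jr_ideal a b r s k l).
Proof. by have H := IJpow_ideal; rewrite /jr_ideal; isideal. Qed.

Lemma jr_colon_ideal a b r s k l : is_ideal (jr_colon a b r s k l).
Proof. by have H := IJpow_ideal; rewrite /jr_colon; isideal. Qed.

Lemma jr_idealP a b r s k l z : jr_ideal a b r s k l z <->
  exists u v, [/\ F r (s + l) u, F (r + k) s v & z = a ^+ k * u + b ^+ l * v].
Proof.
split=> [[_ [u Fu <-] [_ [v Fv <-] <-]]|[u [v [Fu Fv ->]]]]; first by exists u, v.
by exists (a ^+ k * u); [exists u|exists (b ^+ l * v); [exists v|]].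
Qed.

Lemma jr_ideal_sub a b r s k l : I a -> J b ->
  jr_ideal a b r s k l `<=` F (r + k) (s + l).
Proof.
move=> Ia Jb; apply: idealD_sub; first exact: IJpow_ideal.
  by move=> _ [u Fu <-]; apply: IJpow_mul_expl.
by move=> _ [u Fu <-]; apply: IJpow_mul_expr.
Qed.

Lemma jr_colon_sup a b r s k l : I a -> J b -> F r s `<=` jr_colon a b r s k l.
Proof. by move=> Ia Jb x Fx; split; [apply: IJpow_mul_expl|apply: IJpow_mul_expr]. Qed.

Lemma jr_colon_le a b r s k l k' l' : I a -> J b -> (k <= k')%N -> (l <= l')%N ->
  jr_colon a b r s k l `<=` jr_colon a b r s k' l'.
Proof.
move=> Ia Jb kk' ll' x [Hx Hx']; rewrite /jr_colon /colon /=; split.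
  rewrite -(subnKC kk') addnA addnC [(k + _)%N]addnC exprD -mulrA addnC.
  exact: IJpow_mul_expl.
rewrite -(subnKC ll') addnA addnC [(l + _)%N]addnC exprD -mulrA addnC.
exact: IJpow_mul_expr.
Qed.

Lemma joint_reduction_eqE a b r s :
  joint_reduction_eq I J a b r s <-> F r.+1 s.+1 = jr_ideal a b r s 1 1.
Proof. by rewrite /joint_reduction_eq /jr_ideal !expr1 !addn1. Qed.

Lemma joint_reduction_eqSl a b r s : I a -> J b ->
  joint_reduction_eq I J a b r s -> joint_reduction_eq I J a b r.+1 s.
Proof.
move=> Ia Jb /joint_reduction_eqE E; apply/joint_reduction_eqE.
apply/seteqP; split; last by rewrite -[r.+2]addn1 -[s.+1]addn1; exact: jr_ideal_sub.
apply: IJpowSl_sub; first exact: jr_ideal_ideal.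
move=> x y Ix; rewrite E => /jr_idealP[u [v [Fu Fv ->]]]; apply/jr_idealP.
exists (x * u), (x * v); split; last by ring.
  by rewrite -[r.+1]addn1 -[x]expr1; apply: IJpow_mul_expl.
by rewrite addSn -addn1 -[x]expr1; apply: IJpow_mul_expl.
Qed.

Lemma joint_reduction_eqSr a b r s : I a -> J b ->
  joint_reduction_eq I J a b r s -> joint_reduction_eq I J a b r s.+1.
Proof.
move=> Ia Jb /joint_reduction_eqE E; apply/joint_reduction_eqE.
apply/seteqP; split; last by rewrite -[r.+1]addn1 -[s.+2]addn1; exact: jr_ideal_sub.
apply: IJpowSr_sub; first exact: jr_ideal_ideal.
move=> x y Jx; rewrite E => /jr_idealP[u [v [Fu Fv ->]]]; apply/jr_idealP.
exists (x * u), (x * v); split; last by ring.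
  by rewrite addSn -addn1 -[x]expr1; apply: IJpow_mul_expr.
by rewrite -[s.+1]addn1 -[x]expr1; apply: IJpow_mul_expr.
Qed.

(** Write an element as [a u + b v] and expand [u] by induction: the power of [a] rises by one and
    the terms in [b] are collected. *)
Lemma joint_reduction_eq_powl a b r s k : I a -> J b ->
  joint_reduction_eq I J a b r s -> F (r + k) s.+1 `<=` jr_ideal a b r s k 1.
Proof.
move=> Ia Jb jr; elim: k => [|k IH] z Fz.
  apply/jr_idealP; exists z, 0; rewrite addn1; split; [by rewrite -[r]addn0| |by ring].
  exact: ideal0 (IJpow_ideal _ _).
have /joint_reduction_eqE E : joint_reduction_eq I J a b (r + k) s.
  by elim: k {IH Fz} => [|k IH]; rewrite ?addn0 // addnS; apply: joint_reduction_eqSl.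
move: Fz; rewrite addnS E => /jr_idealP[u [v [Fu Fv ->]]].
have /jr_idealP[u' [v' [Fu' Fv' ->]]] : jr_ideal a b r s k 1 u by apply: IH; rewrite -addn1.
apply/jr_idealP; exists u', (a * v' + v); split=> //; last by rewrite !expr1 exprS; ring.
rewrite addnS -addn1; apply: (ideal_add (IJpow_ideal _ _)) => //.
by rewrite -[a]expr1; apply: IJpow_mul_expl.
Qed.

(** Now the coefficient of [b] is the one expanded by induction, while the terms in [a ^+ k] are
    collected. *)
Lemma joint_reduction_eq_pow a b r s k l : I a -> J b ->
  joint_reduction_eq I J a b r s -> F (r + k) (s + l) = jr_ideal a b r s k l.
Proof.
move=> Ia Jb jr; apply/seteqP; split; last exact: jr_ideal_sub.
elim: l => [|l IH] z Fz.
  apply/jr_idealP; exists 0, z; split; [exact: ideal0 (IJpow_ideal _ _)| |by rewrite mul1r mulr0 add0r].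
  by rewrite -[s]addn0.
have jrl : joint_reduction_eq I J a b r (s + l).
  by elim: l {IH Fz} => [|l IH]; rewrite ?addn0 // addnS; apply: joint_reduction_eqSr.
have := joint_reduction_eq_powl Ia Jb jrl (k := k); rewrite -addnS => /(_ _ Fz).
move=> /jr_idealP[u [v [Fu /IH /jr_idealP[u' [v' [Fu' Fv' ->]]] ->]]].
apply/jr_idealP; exists (b * u' + u), v'; split=> //; last by rewrite !expr1 exprS; ring.
rewrite addnS -addn1; apply: (ideal_add (IJpow_ideal _ _)); last by rewrite -addnA addn1 in Fu *.
by rewrite -[b]expr1; apply: IJpow_mul_expr.
Qed.

End Powers.

(** * Joint reductions in a Cohen-Macaulay local ring of dimension two *)

Section JointReduction.
Variables (R : comNzRingType) (m I J : set R).
Hypotheses (R_CM : cohen_macaulay_local m) (R_dim2 : krull_dim R 2).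
Hypotheses (I_m : m_primary m I) (J_m : m_primary m J).
Variables (a b : R).
Hypothesis ab_red : joint_reduction I J a b.
Local Notation F := (IJpow I J).

Let Ia : I a. Proof. by case: ab_red. Qed.
Let Jb : J b. Proof. by case: ab_red. Qed.

Lemma cohen_macaulay_noetherian : noetherian R. Proof. by case: R_CM. Qed.

Lemma m_primary_finite_colength (K : set R) :
  is_ideal K -> m `<=` radical K -> finite_quo setT K.
Proof. by move=> Ki mK; case: R_CM => noeth [mmax _] _; apply: (@finite_colength R m). Qed.

Lemma IJpow_radical r s : m `<=` radical (F r s).
Proof.
move=> x mx; have [n In] : radical I x by case: I_m => _ ->.
have [p Jp] : radical J x by case: J_m => _ ->.
exists (n * r + p * s)%N; rewrite exprD !exprM.
have := IJpow_mul (IJpow_exp (n := r) (IJpow10 (J := J) In)) (IJpow_exp (n := s) (IJpow01 (I := I) Jp)).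
by rewrite !muln0 !muln1 addn0 add0n.
Qed.

Lemma IJpow_finite r s : finite_quo setT (F r s).
Proof. exact: m_primary_finite_colength (IJpow_ideal I J r s) (@IJpow_radical r s). Qed.

(** Far out, the joint reduction equality places [F (N + k) (N + l)] inside [(a^k, b^l)], and every
    element of [m] has a power in the former. *)
Lemma joint_reduction_radical k l : m `<=` radical (ideal2 (a ^+ k) (b ^+ l)).
Proof.
have [_ _ [N jrN]] := ab_red; move=> x /(IJpow_radical (N + k) (N + l)) [n].
rewrite (joint_reduction_eq_pow _ _ Ia Jb (jrN N N _ _)) // => /jr_idealP[u [v [_ _ E]]].
by exists n; apply/ideal2P; exists u, v.
Qed.

Lemma joint_reduction_koszul : koszul_exact a b.
Proof.
by apply: (parameters_koszul_exact R_CM R_dim2); exact: (joint_reduction_radical 1 1).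
Qed.

Lemma joint_reduction_nonzerodiv : nonzerodiv a /\ nonzerodiv b.
Proof.
have [noeth mloc _] := R_CM.
have sub (K : set R) : m_primary m K -> K `<=` m.
  by case=> _ <- x Kx; exists 1; rewrite expr1.
split; first exact: koszul_exact_nonzerodiv noeth mloc (sub _ J_m _ Jb) joint_reduction_koszul.
exact: koszul_exact_nonzerodiv noeth mloc (sub _ I_m _ Ia) (koszul_exactC joint_reduction_koszul).
Qed.

Lemma jr_ideal_finite r s k l : finite_quo setT (jr_ideal I J a b r s k l).
Proof.
apply: m_primary_finite_colength; first exact: jr_ideal_ideal.
move=> x mx; have [n /ideal2P[u [v E]]] := joint_reduction_radical k l mx.
have [p Fp] := IJpow_radical r (s + l) mx; have [q Fq] := IJpow_radical (r + k) s mx.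
(* The factor [x ^+ n] supplies a combination of [a ^+ k] and [b ^+ l]; the factors [x ^+ p] and
   [x ^+ q] put its coefficients into [F r (s + l)] and [F (r + k) s]. *)
exists (n + (p + q))%N; rewrite exprD E exprD; apply/jr_idealP.
exists (u * x ^+ q * x ^+ p), (v * x ^+ p * x ^+ q); split; last by ring.
  exact: ideal_mull (IJpow_ideal _ _ _ _) _.
exact: ideal_mull (IJpow_ideal _ _ _ _) _.
Qed.

(** This is [colength_koszul] for [a ^+ k], [b ^+ l], [F r (s + l)] and [F (r + k) s], after
    splitting [R / Q] at [F (r + k) (s + l)] and [R / F r s] at [K]. The terms are arranged to avoid
    subtraction in [nat]. *)
Lemma joint_reduction_colength r s k l :
  (colength (F (r + k) (s + l)) + quo_length (F (r + k) (s + l)) (jr_ideal I J a b r s k l)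
     + colength (F r s)
   = k * l * colength (ideal2 a b) + colength (F r (s + l)) + colength (F (r + k) s)
     + quo_length (jr_colon I J a b r s k l) (F r s))%N.
Proof.
have Fi := IJpow_ideal I J.
have Ci := jr_colon_ideal I J a b r s k l.
have Qi := jr_ideal_ideal I J a b r s k l.
have Csup := @jr_colon_sup R I J a b r s k l Ia Jb.
have ab := koszul_exactX (k := k) (l := l) joint_reduction_koszul.
have fC : finite_quo setT (jr_colon I J a b r s k l).
  exact: finite_quo_sub Ci Csup (@subsetT _ _) (@subset_refl _ _) (IJpow_finite r s).
have /= := colength_koszul ab (Fi r (s + l)%N) (Fi (r + k)%N s) (jr_ideal_finite _ _ _ _)
  (IJpow_finite _ _) (IJpow_finite _ _) fC.
rewrite -/(jr_ideal _ _ _ _ _ _ _ _) -/(jr_colon _ _ _ _ _ _ _ _).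
rewrite (colength_ideal2X _ _ joint_reduction_koszul); last first.
  move=> k' l'; apply: m_primary_finite_colength; first exact: ideal2_ideal.
  exact: joint_reduction_radical.
have := quo_lengthD Qi (Fi _ _) (@idealT R) (@jr_ideal_sub R I J a b r s k l Ia Jb)
  (@subsetT _ _) (jr_ideal_finite _ _ _ _).
have := quo_lengthD (Fi r s) Ci (@idealT R) Csup (@subsetT _ _) (IJpow_finite r s).
rewrite -!/(colength _); lia.
Qed.

(** The colon ideals increase in both exponents, and the diagonal is cofinal and stationary. *)
Lemma jr_colon_stationary r s : exists N, forall k l, (N <= k)%N -> (N <= l)%N ->
  jr_colon I J a b r s k l = jr_colon I J a b r s N N.
Proof.
have [|n|N HN] := noetherian_stationary cohen_macaulay_noetherian
  (L := fun n => jr_colon I J a b r s n n).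
- by move=> n; exact: jr_colon_ideal.
- exact: jr_colon_le.
exists N => k l Nk Nl; apply/seteqP; split; last exact: jr_colon_le.
rewrite -(HN (maxn k l)); last by lia.
by apply: jr_colon_le => //; lia.
Qed.

End JointReduction.

(** * Monomials and coefficients of Laurent polynomials *)

Section LaurentMonomials.
Variable R : comNzRingType.
Implicit Types (f g : laurent R) (d e : int * int) (c : R).

Lemma lmonomM c d c' e : lmonom c d * lmonom c' e = lmonom (c * c') (d + e).
Proof.
rewrite laurentME !msuppU; case: eqP => [->|_].
  by rewrite big_seq_fset0 mul0r /lmonom monalgU0.
rewrite big_seq_fset1; case: eqP => [->|_].
  by rewrite big_seq_fset0 mulr0 /lmonom monalgU0.
by rewrite big_seq_fset1 !lcoef_monom !eqxx.
Qed.

Lemma lmonomX c d n : lmonom c d ^+ n = lmonom (c ^+ n) (d *+ n).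
Proof.
elim: n => [|n IH]; first by rewrite !expr0 mulr0n.
by rewrite !exprS mulrS IH lmonomM.
Qed.

Lemma lcoef_mul_monom f c d e : lcoef (d + e) (f * lmonom c e) = lcoef d f * c.
Proof.
elim/laurent_ind: f => [|f g Hf Hg|c' d'].
- by rewrite mul0r /lcoef !mcoeff0 mul0r.
- by rewrite (mulrDl f g) !lcoefD Hf Hg mulrDl.
rewrite lmonomM !lcoef_monom; have -> : (d' + e == d + e) = (d' == d).
  by apply/eqP/eqP => [/addIr|->].
by case: eqP; rewrite ?mulr0n ?mul0r.
Qed.

Lemma lmonomD c c' d : lmonom (c + c') d = lmonom c d + lmonom c' d.
Proof. exact: monalgUD. Qed.

Lemma laurent_ext f g : (forall d, lcoef d f = lcoef d g) -> f = g.
Proof. by move=> fg; apply/malgP. Qed.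

End LaurentMonomials.

(** * Čech classes of the Rees algebra in one bidegree *)

Section CechIdentities.
Variable S : comNzRingType.
Implicit Types (x y z u v : S).

(** The equality [z / (x y)^k = u / y^n + v / x^n] with denominators cleared; the inner minus signs
    come from the Čech boundary. The factors [y ^+ 0] and [x ^+ 0] give both summands the shape
    expected by [val_mulX_monomial]. *)
Lemma cech_identity x y z u v k N n : n = (k + N)%N ->
  z * x ^+ N * y ^+ N = u * x ^+ n * y ^+ 0 + v * x ^+ 0 * y ^+ n ->
  (x * y) ^+ 0 * ((u * x ^+ n * (x * y) ^+ n + - (- v * y ^+ n) * (x * y) ^+ n) * (x * y) ^+ k
    - z * (x * y) ^+ (n + n)) = 0.
Proof.
rewrite !expr0 !mulr1 mul1r => nE E; transitivity ((x * y) ^+ n * (x * y) ^+ k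
    * (u * x ^+ n + v * y ^+ n - z * x ^+ N * y ^+ N)).
  by rewrite nE !exprMn !exprD; ring.
by rewrite E subrr mulr0.
Qed.

(** Multiplies out [z / (x y) = v / y^p - u / x^q], an equality that holds in the localization up to
    the factor [(x y)^n]. *)
Lemma cech_identity_inv x y z u v n p q :
  (x * y) ^+ n * ((v * x ^+ p * (x * y) ^+ q + - (u * y ^+ q) * (x * y) ^+ p) * (x * y) ^+ 1
    - z * (x * y) ^+ (p + q)) = 0 ->
  z * x ^+ (n + p + q) * y ^+ (n + p + q)
  = v * x ^+ (n + p + q).+1 * y ^+ (n + q).+1 - u * x ^+ (n + p).+1 * y ^+ (n + p + q).+1.
Proof.
move=> E; apply/eqP; rewrite -subr_eq0 -oppr_eq0; apply/eqP; rewrite -[RHS]E.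
by rewrite expr1 !exprMn !exprS !exprD; ring.
Qed.

End CechIdentities.

Lemma fracP (S : comNzRingType) (f : S) (w : loc f) : exists s n, w = Defs.frac f s n.
Proof. by exists (Defs.num w), (Defs.den w); rewrite fracK. Qed.

Section LocalCohomology.
Variables (R : comNzRingType) (I J : set R) (a b : R) (r s : nat).
Hypotheses (Ia : I a) (Jb : J b).
Implicit Types (X Y Z : rees I J) (u z : R) (i j k n p q : nat).
Local Notation F := (IJpow I J).
Local Notation x := (rees_t1 I J a).
Local Notation y := (rees_t2 I J b).
Local Notation deg i j := ((i%:Z, j%:Z) : int * int).

Lemma degD i j p q : deg i j + deg p q = deg (i + p) (j + q).
Proof. by []. Qed.

Lemma degMn i j n : deg i j *+ n = deg (i * n) (j * n).
Proof.
elim: n => [|n IH]; first by rewrite mulr0n !muln0.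
by rewrite mulrS IH degD !mulnS.
Qed.

Lemma rees_coef Z i j : F i j (lcoef (deg i j) (val Z)).
Proof. by have /asboolP/(_ (deg i j)) := valP Z. Qed.

Lemma val_reesD Z Z' : val (Z + Z') = val Z + val Z'. Proof. exact: rmorphD. Qed.

Lemma val_reesB Z Z' : val (Z - Z') = val Z - val Z'. Proof. exact: rmorphB. Qed.

Lemma rees_monomial u i j : F i j u -> exists Z, val Z = lmonom u (deg i j).
Proof.
move=> Fu; have uP : lmonom u (deg i j) \in rees_pred I J.
  apply/asboolP => e; rewrite lcoef_monom.
  by case: eqP => [<-//|_]; apply: ideal0; apply: IJpowz_ideal.
by exists (Sub (lmonom u (deg i j)) uP); rewrite SubK.
Qed.

Lemma val_rees_homog Z i j : rees_homog (deg i j) Z ->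
  val Z = lmonom (lcoef (deg i j) (val Z)) (deg i j).
Proof.
move=> ZH; apply: laurent_ext => e; rewrite lcoef_monom.
by case: eqP => [->//|/eqP]; rewrite eq_sym => /ZH.
Qed.

Lemma rees_homog_monomial Z u i j : val Z = lmonom u (deg i j) -> rees_homog (deg i j) Z.
Proof. by move=> ZE e; rewrite ZE lcoef_monom eq_sym => /negPf->. Qed.

Lemma val_reesM Z Z' : val (Z * Z') = val Z * val Z'. Proof. exact: rmorphM. Qed.

Lemma val_reesX Z n : val (Z ^+ n) = val Z ^+ n. Proof. exact: rmorphXn. Qed.

Lemma val_mul_exp Z X Y f g p q : val X = f -> val Y = g ->
  val (Z * X ^+ p * Y ^+ q) = val Z * f ^+ p * g ^+ q.
Proof. by move=> <- <-; rewrite !val_reesM !val_reesX. Qed.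

Lemma val_mulX Z p q :
  val (Z * x ^+ p * y ^+ q) = val Z * lmonom (a ^+ p * b ^+ q) (deg p q).
Proof.
rewrite (val_mul_exp _ _ _ (val_rees_t1 J Ia) (val_rees_t2 I Jb)) !lmonomX -mulrA lmonomM.
by rewrite (degMn 1 0) (degMn 0 1) degD !mul0n !mul1n addn0 add0n.
Qed.

Lemma lcoef_mulX Z i j p q :
  lcoef (deg (i + p) (j + q)) (val (Z * x ^+ p * y ^+ q))
  = lcoef (deg i j) (val Z) * (a ^+ p * b ^+ q).
Proof. by rewrite val_mulX -degD lcoef_mul_monom. Qed.

Lemma val_mulX_monomial Z z i j p q : val Z = lmonom z (deg i j) ->
  val (Z * x ^+ p * y ^+ q) = lmonom (z * (a ^+ p * b ^+ q)) (deg (i + p) (j + q)).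
Proof. by move=> ZE; apply: etrans (val_mulX _ _ _) _; rewrite ZE lmonomM degD. Qed.

Lemma lc2_zero : rees_lc2 I J a b (deg r s) 0.
Proof.
exists 0%N, 0; split; first by move=> e _; rewrite /lcoef rmorph0 mcoeff0.
apply/esym/lc2_class_eq0; exists (Defs.frac x 0 0, Defs.frac y 0 0) => //.
rewrite /cech_boundary /= loc_right_frac loc_left_frac fracN fracD.
by apply/frac_eqP; exists 0%N; ring.
Qed.

(** Extending the fraction [z / (x y)^k] by [(x y)^N] brings its numerator to exponent [k + N],
    where [HN] writes it with terms in [x^n] and [y^n]; so the fraction is a Čech boundary. *)
Lemma lc2_vanish N :
  (forall k, (N <= k)%N -> F (r + k) (s + k) `<=` jr_ideal I J a b r s k k) ->
  rees_lc2 I J a b (deg r s) = [set 0].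
Proof.
move=> HN; apply/seteqP; split=> [_ [k [Z [ZH ->]]]|_ ->]; last exact: lc2_zero.
move: ZH; rewrite (degMn 1 1) degD !mul1n => ZH.
apply/lc2_class_eq0; set z := lcoef (deg (r + k) (s + k)) (val Z).
have Fz : F (r + k + N) (s + k + N) (a ^+ N * b ^+ N * z).
  rewrite -mulrA; apply: IJpow_mul_expl => //; apply: IJpow_mul_expr => //.
  exact: rees_coef.
pose n := (k + N)%N.
have /jr_idealP[u [v [Fu Fv zE]]] : jr_ideal I J a b r s n n (a ^+ N * b ^+ N * z).
  by apply: HN; [rewrite /n; lia|rewrite /n !addnA].
have [U UE] := rees_monomial Fu; have [V VE] := rees_monomial Fv.
have E : Z * x ^+ N * y ^+ N = U * x ^+ n * y ^+ 0 + V * x ^+ 0 * y ^+ n.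
  apply: val_inj; apply: etrans (val_mulX_monomial N N (val_rees_homog ZH)) _.
  apply: etrans _ (esym (val_reesD _ _)).
  apply: etrans _ (esym (congr2 +%R (val_mulX_monomial n 0 UE) (val_mulX_monomial 0 n VE))).
  rewrite -/z !addn0 -lmonomD /n !addnA; congr lmonom.
  by rewrite mulrC zE !expr0 mulr1 mul1r mulrC [v * _]mulrC.
exists (Defs.frac x (- V) n, Defs.frac y U n) => //.
rewrite /cech_boundary /= loc_right_frac loc_left_frac fracN fracD.
by apply/frac_eqP; exists 0%N; exact: (cech_identity (erefl n) E).
Qed.

(** Only the classes [z / (x y)] are needed. The equality saying that such a class is a boundary is
    compared in the single bidegree [(r + 1 + M, s + 1 + M)]. *)
Lemma lc2_vanish_coef : rees_lc2 I J a b (deg r s) = [set 0] ->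
  forall z, F r.+1 s.+1 z -> exists M u v, [/\ F r (s + M.+1) u, F (r + M.+1) s v &
    (a * b) ^+ M * z = a ^+ M.+1 * u + b ^+ M.+1 * v].
Proof.
move=> H0 z Fz; have [Z ZE] := rees_monomial Fz.
have : rees_lc2 I J a b (deg r s) (lc2_class (Defs.frac (x * y) Z 1)).
  exists 1%N, Z; split => //; rewrite (degMn 1 1) degD !muln1 !addn1.
  exact: rees_homog_monomial ZE.
rewrite H0 => /lc2_class_eq0 [[w w'] _].
have [U [q ->]] := fracP w; have [V [p ->]] := fracP w'; rewrite /cech_boundary /=.
rewrite loc_right_frac loc_left_frac fracN fracD => /frac_eqP[n E].
pose M := (n + p + q)%N.
have {}E : Z * x ^+ M * y ^+ M
         = V * x ^+ M.+1 * y ^+ (n + q).+1 - U * x ^+ (n + p).+1 * y ^+ M.+1.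
  exact: cech_identity_inv E.
(* The two terms of [E] carry unequal powers of [x] and [y]; beyond [a ^+ M.+1] in one and
   [b ^+ M.+1] in the other, the remaining powers go into the coefficients. *)
exists M, (b ^+ (n + q).+1 * lcoef (deg r (s + p)) (val V)),
  (- (a ^+ (n + p).+1 * lcoef (deg (r + q) s) (val U))); split.
- have -> : (s + M.+1 = s + p + (n + q).+1)%N by rewrite /M; lia.
  by apply: IJpow_mul_expr => //; apply: rees_coef.
- rewrite -mulrN -mulN1r; have -> : (r + M.+1 = r + q + (n + p).+1)%N by rewrite /M; lia.
  apply: IJpow_mul_expl => //; apply: (ideal_mull _ (IJpow_ideal _ _ _ _)).
  exact: rees_coef.
have := congr1 (fun f => lcoef (deg (r.+1 + M) (s.+1 + M)) (val f)) E.
rewrite lcoef_mulX ZE lcoef_monom eqxx mulr1n val_reesB lcoefD lcoefN.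
have -> : deg (r.+1 + M) (s.+1 + M) = deg (r + M.+1) (s + p + (n + q).+1).
  by congr (Posz _, Posz _); rewrite /M; lia.
rewrite lcoef_mulX.
have -> : deg (r + M.+1) (s + p + (n + q).+1) = deg (r + q + (n + p).+1) (s + M.+1).
  by congr (Posz _, Posz _); rewrite /M; lia.
rewrite lcoef_mulX exprMn => E'; rewrite mulrC E'; ring.
Qed.

End LocalCohomology.

(** * Numerical polynomials, and cancellation of powers *)

Lemma bin2_succ n : 'C(n.+1 + 1, 2)%:Z = 'C(n + 1, 2)%:Z + n%:Z + 1.
Proof. by rewrite !addn1 binS bin1; lia. Qed.

(** Six values suffice: the mixed difference isolates [A], the second differences [B] and [C], the
    first differences [x] and [y]. *)
Lemma quadratic_eq0 (A B C x y z : int) (U : nat) :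
  (forall u v : nat, (U <= u)%N -> (U <= v)%N ->
    A * u%:Z * v%:Z + B * 'C(u + 1, 2)%:Z + C * 'C(v + 1, 2)%:Z
      + x * u%:Z + y * v%:Z + z = 0) ->
  [/\ A = 0, B = 0, C = 0, x = 0 & y = 0 /\ z = 0].
Proof.
move=> H; have H00 := H U U (leqnn _) (leqnn _).
have H10 := H U.+1 U (leqnSn _) (leqnn _).
have H01 := H U U.+1 (leqnn _) (leqnSn _).
have H11 := H U.+1 U.+1 (leqnSn _) (leqnSn _).
have H20 : _ = 0 := H U.+2 U (ltnW (leqnSn _)) (leqnn _).
have H02 : _ = 0 := H U U.+2 (leqnn _) (ltnW (leqnSn _)).
rewrite !bin2_succ in H10 H01 H11 H20 H02.
move: H00 H10 H01 H11 H20 H02; move: ('C(U + 1, 2)) => t.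
rewrite -![in U.+2%:Z]addn1 -![in U.+1%:Z]addn1 !PoszD => H00 H10 H01 H11 H20 H02.
have A0 : A = 0 by lia.
have B0 : B = 0 by move: H00 H10 H20; rewrite A0; lia.
have C0 : C = 0 by move: H00 H01 H02; rewrite A0; lia.
have x0 : x = 0 by move: H00 H10; rewrite A0 B0 C0; lia.
have y0 : y = 0 by move: H00 H01; rewrite A0 B0 C0; lia.
by split=> //; split=> //; move: H00; rewrite A0 B0 C0 x0 y0; lia.
Qed.

(** The truncated subtraction in [r + i - 1] is harmless at [i = 0], where the binomial coefficient
    is [1] in any case; likewise for [j]. *)
Lemma bigraded_sumE (e : nat -> nat -> int) (r s : nat) :
  \sum_(i < 3) \sum_(j < 3 | (i + j <= 2)%N)
     (-1) ^+ (i + j) * e i j * 'C(r + i - 1, i)%:Z * 'C(s + j - 1, j)%:Z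
  = e 1%N 1%N * r%:Z * s%:Z + e 2%N 0%N * 'C(r + 1, 2)%:Z + e 0%N 2%N * 'C(s + 1, 2)%:Z
    - e 1%N 0%N * r%:Z - e 0%N 1%N * s%:Z + e 0%N 0%N.
Proof.
have rE : (r + 2 - 1 = r + 1)%N by lia.
have sE : (s + 2 - 1 = s + 1)%N by lia.
under eq_bigr do rewrite big_mkcond.
rewrite !big_ord_recl !big_ord0 /= /bump /= !bin0 !add1n !addnK !bin1 rE sE.
rewrite !addn0; ring.
Qed.

(** The factors [a] are removed one at a time: an element [a ^+ k.+1 * x] of [(a) ∩ F (k.+1 + j)]
    lies in [a F (k + j)], and [a] cancels. *)
Lemma cap_colon (R : comNzRingType) (F : nat -> set R) (a : R) j k x : nonzerodiv a ->
  (forall k, (1 <= k)%N -> ideal_gen [set a] `&` F k = scale_ideal a (F (k - 1)%N)) ->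
  F (k + j)%N (a ^+ k * x) -> F j x.
Proof.
move=> aP cap; elim: k => [|k IH] Fk; first by rewrite mul1r in Fk.
apply: IH; have : scale_ideal a (F (k.+1 + j - 1)%N) (a ^+ k.+1 * x).
  rewrite -cap; last by lia.
  by split=> //; rewrite ideal_gen1; exists (a ^+ k * x); rewrite // exprS mulrA.
rewrite exprS -mulrA => -[w Fw /(nonzerodivI aP) <-].
by rewrite addSn subn1 in Fw.
Qed.

(** * Relations between the Hilbert coefficients *)

Section HilbertCoefficients.
Variables (R : comNzRingType) (m I J : set R).
Hypotheses (R_CM : cohen_macaulay_local m) (R_dim2 : krull_dim R 2).
Hypotheses (I_m : m_primary m I) (J_m : m_primary m J).
Variables (eI eJ eIJ : nat -> int) (e : nat -> nat -> int) (g1 g2 h1 h2 : nat -> int).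
Hypotheses (eIJ_def : hilbert_coefs (idealM I J) eIJ).
Hypotheses (e_def : bigraded_hilbert_coefs I J e).
Hypotheses (g_def : row_coefs I J (eJ 0%N) g1 g2).
Hypotheses (h_def : col_coefs I J (eI 0%N) h1 h2).
Local Notation F := (IJpow I J).

(* At [(r, s)] large, [H^2] vanishes and the colon ideals are stationary, so that every
   coefficient of the polynomial of [joint_reduction_colength] is zero. *)
Lemma mixed_multiplicity a b : joint_reduction I J a b ->
  [/\ e 1%N 1%N = (colength (ideal2 a b))%:Z, eI 0%N = e 2%N 0%N & eJ 0%N = e 0%N 2%N].
Proof.
move=> ab_red; have [Ia Jb [N jrN]] := ab_red.
have [N1 eE] := e_def; pose r := maxn N N1.
have [N2 gE] := g_def r; have [N3 hE] := h_def r.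
have [N4 CE] := jr_colon_stationary R_CM ab_red r r.
pose U := maxn (maxn N2 N3) N4; set lam := colength _.
set kap := quo_length (jr_colon I J a b r r N4 N4) (F r r).
suff [? ? ? _ _] : [/\ lam%:Z - e 1%N 1%N = 0, eI 0%N - e 2%N 0%N = 0, eJ 0%N - e 0%N 2%N = 0,
    e 1%N 0%N - h1 r - r%:Z * lam%:Z = 0 & e 0%N 1%N - g1 r - r%:Z * lam%:Z = 0
    /\ r%:Z * r%:Z * lam%:Z + g2 r + h2 r + kap%:Z - (colength (F r r))%:Z - e 0%N 0%N = 0].
  by split; lia.
apply: (quadratic_eq0 (U := r + U)%N) => u v Uu Uv.
have [k uE] : exists k, u = (r + k)%N by exists (u - r)%N; lia.
have [l vE] : exists l, v = (r + l)%N by exists (v - r)%N; lia.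
have := joint_reduction_colength R_CM R_dim2 I_m J_m ab_red r r k l.
rewrite -(joint_reduction_eq_pow k l Ia Jb (jrN r r (leq_maxl _ _) (leq_maxl _ _))).
rewrite quo_lengthxx; last exact: IJpow_ideal.
rewrite CE ?/U; try lia.
rewrite -/lam -/kap -uE -vE.
have := gE v; have := hE u; have := eE u v.
rewrite bigraded_sumE.
move=> /(_ ltac:(lia) ltac:(lia)) E1 /(_ ltac:(lia)) E2 /(_ ltac:(lia)) E3 E4.
have {}E4 := congr1 Posz E4; rewrite !PoszD !PoszM E1 E2 E3 in E4.
have kE : k%:Z = u%:Z - r%:Z by lia.
have lE : l%:Z = v%:Z - r%:Z by lia.
rewrite kE lE in E4; lia.
Qed.

(** Both polynomials compute the colength of [(I J)^n] for large [n], and each side is the value at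
    [n = 0] of its polynomial. *)
Lemma hilbert_coef2_idealM : eIJ 2%N = e 0%N 0%N.
Proof.
have [N1 EIJ] := eIJ_def; have [N2 E] := e_def.
have H n : (maxn N1 N2 <= n)%N ->
    e 1%N 1%N * n%:Z * n%:Z + (e 2%N 0%N + e 0%N 2%N - eIJ 0%N) * 'C(n + 1, 2)%:Z
      + (eIJ 1%N - e 1%N 0%N - e 0%N 1%N) * n%:Z + (e 0%N 0%N - eIJ 2%N) = 0.
  move=> Nn; have := EIJ n ltac:(lia); rewrite idealX_idealM.
  have := E n n ltac:(lia) ltac:(lia); rewrite bigraded_sumE => -> /eqP.
  by rewrite -subr_eq0 => /eqP H; rewrite -[RHS]H; ring.
have Tn n : 'C(n + 1, 2)%:Z *+ 2 = n%:Z * (n%:Z + 1).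
  by elim: n => [|n IH]; [|rewrite bin2_succ; lia].
(* Three consecutive zeros determine a polynomial of degree at most two; [Tn] relates [n ^ 2] to the
   binomial basis. *)
move: (maxn N1 N2) H => U H; move: (H U (leqnn _)) (H U.+1 (leqnSn _)) (H U.+2 (ltnW (leqnSn _))).
rewrite !bin2_succ; have := Tn U; move: ('C(U + 1, 2)) => t tE.
move: (e 1%N 1%N) (_ - eIJ 0%N) (eIJ 1%N - _ - _) => A B C H0 H1 H2.
nia.
Qed.

(** By [mixed_multiplicity] all quadratic terms cancel. Writing [k l] as a product of differences of
    the total exponents [r + k] and [s + l] leaves the corrections by [e 1 1]. The right-hand side
    does not depend on the joint reduction. *)
Lemma joint_reduction_poly a b r s : joint_reduction I J a b ->
  exists U, forall k l, (U <= k)%N -> (U <= l)%N ->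
    (quo_length (F (r + k) (s + l)) (jr_ideal I J a b r s k l))%:Z
      - (quo_length (jr_colon I J a b r s k l) (F r s))%:Z
    = (e 1%N 0%N - h1 s - s%:Z * e 1%N 1%N) * (r + k)%:Z
      + (e 0%N 1%N - g1 r - r%:Z * e 1%N 1%N) * (s + l)%:Z
      + (r%:Z * s%:Z * e 1%N 1%N + g2 r + h2 s - (colength (F r s))%:Z - eIJ 2%N).
Proof.
move=> ab_red; have [e11 e20 e02] := mixed_multiplicity ab_red.
have [N1 eE] := e_def; have [N2 gE] := g_def r; have [N3 hE] := h_def s.
exists (maxn N1 (maxn N2 N3)) => k l Uk Ul.
have := joint_reduction_colength R_CM R_dim2 I_m J_m ab_red r s k l.
have := gE (s + l)%N ltac:(lia); have := hE (r + k)%N ltac:(lia).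
have := eE (r + k)%N (s + l)%N ltac:(lia) ltac:(lia).
rewrite bigraded_sumE hilbert_coef2_idealM e20 e02 => E1 E2 E3 E4.
have {}E4 := congr1 Posz E4; rewrite !(PoszD, PoszM) E1 E2 E3 -e11 in E4.
rewrite !PoszD in E4 *; lia.
Qed.

End HilbertCoefficients.

Theorem theorem4p9 (R : comNzRingType) (m I J : set R) (r0 s0 : nat) (a b : R)
    (eI eJ eIJ : nat -> int) (e : nat -> nat -> int)
    (g1 g2 h1 h2 : nat -> int)
    (R_CM : cohen_macaulay_local m)
    (R_dim2 : krull_dim R 2)
    (R_res : infinite_residue_field m)
    (I_m : m_primary m I)
    (J_m : m_primary m J)
    (eI_def : hilbert_coefs I eI)
    (eJ_def : hilbert_coefs J eJ)
    (eIJ_def : hilbert_coefs (idealM I J) eIJ)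
    (e_def : bigraded_hilbert_coefs I J e)
    (g_def : row_coefs I J (eJ 0%N) g1 g2)
    (h_def : col_coefs I J (eI 0%N) h1 h2)
    (ab_red : joint_reduction I J a b)
    (a_cap : forall k : nat, (1 <= k)%N ->
       ideal_gen [set a] `&` IJpow I J (r0 + k) s0 =
       scale_ideal a (IJpow I J (r0 + k - 1) s0))
    (b_cap : forall k : nat, (1 <= k)%N ->
       ideal_gen [set b] `&` IJpow I J r0 (s0 + k) =
       scale_ideal b (IJpow I J r0 (s0 + k - 1))) :
  let stmt_a := joint_reduction_lattice I J (r0, s0) in
  let stmt_b :=
    [/\ e 0%N 1%N = g1 r0 + r0%:Z * e 1%N 1%N,
        e 1%N 0%N = h1 s0 + s0%:Z * e 1%N 1%N &
        eIJ 2%N = g2 r0 + h2 s0 - (colength (IJpow I J r0 s0))%:Z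
                  + r0%:Z * s0%:Z * e 1%N 1%N
                  + (quo_length (Ftilde I J a b r0 s0) (IJpow I J r0 s0))%:Z] in
  let stmt_c := rees_lc2 I J a b (r0%:Z, s0%:Z) = [set 0] in
  (stmt_a <-> stmt_b) /\ (stmt_b <-> stmt_c).
Proof.
move=> stmt_a stmt_b stmt_c.
have [Ia Jb _] := ab_red.
have [aP bP] := joint_reduction_nonzerodiv R_CM R_dim2 I_m J_m ab_red.
have ab := joint_reduction_koszul R_CM R_dim2 I_m J_m ab_red.
have Fi := IJpow_ideal I J.
(* The two intersection hypotheses are recast as cancellation of powers of [a] and of [b]. *)
have {}a_cap j k x : IJpow I J (r0 + (k + j)) s0 (a ^+ k * x) -> IJpow I J (r0 + j) s0 x.
  apply: (cap_colon (F := fun n => IJpow I J (r0 + n) s0) aP) => n n0.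
  by rewrite a_cap // addnBA.
have {}b_cap j k x : IJpow I J r0 (s0 + (k + j)) (b ^+ k * x) -> IJpow I J r0 (s0 + j) x.
  apply: (cap_colon (F := fun n => IJpow I J r0 (s0 + n)) bP) => n n0.
  by rewrite b_cap // addnBA.
have colonE k l : jr_colon I J a b r0 s0 k l = IJpow I J r0 s0.
  apply/seteqP; split; last exact: jr_colon_sup.
  by move=> x [ax _]; rewrite -[r0]addn0; apply: (a_cap _ k); rewrite addn0.
(* Each term of the union is the colon ideal with [l = k], so the last length in [stmt_b] is
   zero. *)
have FtildeE : Ftilde I J a b r0 s0 = IJpow I J r0 s0.
  apply/seteqP; split; first by move=> x [k _ Cx]; rewrite -(colonE k k).
  by move=> x Fx; exists 1%N => //; apply: (@jr_colon_sup R I J a b r0 s0 1 1).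
have {}polyE := joint_reduction_poly R_CM R_dim2 I_m J_m eIJ_def e_def g_def h_def.
have [U abU] := polyE a b r0 s0 ab_red.
have Fxx := quo_lengthxx (Fi r0 s0).
have ab_imp : stmt_a -> stmt_b.
  move=> [a' [b' [ab'_red jr']]].
  have [Ia' Jb' _] := ab'_red.
  have [U' abU'] := polyE a' b' r0 s0 ab'_red.
  rewrite /stmt_b FtildeE Fxx.
  (* The polynomial has degree one, so the three quadratic coefficients passed to [quadratic_eq0]
     are [0]. *)
  suff [_ _ _ ? [? ?]] : [/\ (0 : int) = 0, (0 : int) = 0, (0 : int) = 0,
      e 1%N 0%N - h1 s0 - s0%:Z * e 1%N 1%N = 0 &
      e 0%N 1%N - g1 r0 - r0%:Z * e 1%N 1%N = 0
      /\ r0%:Z * s0%:Z * e 1%N 1%N + g2 r0 + h2 s0 - (colength (IJpow I J r0 s0))%:Z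
         - eIJ 2%N = 0].
    by split; lia.
  apply: (quadratic_eq0 (U := r0 + s0 + U + U')%N) => u v Uu Uv.
  have [k uE] : exists k, u = (r0 + k)%N by exists (u - r0)%N; lia.
  have [l vE] : exists l, v = (s0 + l)%N by exists (v - s0)%N; lia.
  have := abU' k l ltac:(lia) ltac:(lia); have := abU k l ltac:(lia) ltac:(lia).
  (* The same polynomial equals a length for [(a, b)], where [K = F], and minus a length for
     [(a', b')], where [Q = F]. *)
  rewrite colonE Fxx -(joint_reduction_eq_pow k l Ia' Jb' jr') quo_lengthxx //.
  by rewrite -uE -vE; lia.
have bc_imp : stmt_b -> stmt_c.
  rewrite /stmt_b FtildeE Fxx => -[e01 e10 e2].
  apply: (lc2_vanish Ia Jb (N := U)) => k Uk.
  have := abU k k Uk Uk; rewrite colonE Fxx => E.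
  suff <- : IJpow I J (r0 + k) (s0 + k) = jr_ideal I J a b r0 s0 k k by [].
  apply: quo_length_eq0 => //; [exact: jr_ideal_ideal|exact: jr_ideal_sub| |].
    exact: (jr_ideal_finite R_CM I_m J_m ab_red).
  move: E; rewrite e01 e10 e2; lia.
have ca_imp : stmt_c -> stmt_a.
  move=> H2; exists a, b; split=> //=; apply/joint_reduction_eqE.
  apply/seteqP; split=> z; last by move/(jr_ideal_sub Ia Jb); rewrite !addn1.
  move=> /(lc2_vanish_coef Ia Jb H2) [M [u [v [Fu Fv E]]]].
  (* Injectivity of the direct system. Here [a^M (b^M z - a u) = b^M (b v)] gives
     [b^M z - a u = b^M w] and [b v = a^M w]. Two further Koszul relations then yield [u = b^M u']
     and [v = a^M v'], and cancelling powers puts [u'] and [v'] into the required ideals. *)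
  have [|w [zE bvE]] := koszul_exactX (k := M) (l := M) ab (p := b ^+ M * z - a * u) (q := b * v).
    by rewrite mulrBr [X in X - _]mulrA -exprMn E !exprS; ring.
  have [|u' [uE _]] := koszul_exactX (k := 1) (l := M) ab (p := u) (q := z - w).
    by rewrite expr1 mulrBr -zE; ring.
  have [|v' [_ vE]] := koszul_exactX (k := M) (l := 1) ab (p := w) (q := v).
    by rewrite expr1 -bvE.
  apply/jr_idealP; exists u', v'; split.
  - by apply: (b_cap _ M); rewrite addn1 -uE.
  - by apply: (a_cap _ M); rewrite addn1 -vE.
  apply: (@nonzerodivI _ ((a * b) ^+ M)); first exact/nonzerodivX/nonzerodivM.
  by rewrite !expr1 E uE vE !exprMn !exprS; ring.
by split; split=> H; auto.
Qed.
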